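(* Let $\Bbbk$ be an algebraically closed field of characteristic $2$ and let $\mathfrak{u}(\mathfrak{m})$ be the algebra generated by $a,b,c$ with relations $ab+ba=c$, $ac+ca=a$, $bc+cb=b$, $a^4=b^4=0$, $c^2+c=0$. The set of isomorphism classes of finite-dimensional indecomposable left $\mathfrak{u}(\mathfrak{m})$-modules consists of the classes of: (i) the simple modules $V_0,V_1$ and their projective covers $P(V_0)\simeq M$, $P(V_1)\simeq N$; (ii) the string modules $\mathtt U_{i,r}$ ($i\in\{1,2,3,4\}$, $r\ge1$), $\mathtt V_{j,t}$, $\mathtt W_{j,t}$ ($j\in\{1,2\}$, $t\ge0$); (iii) the band modules $\mathtt A_{\lambda,n}$, $\mathtt B_{\lambda,n}$ ($n\ge1$, $\lambda\in\Bbbk^\times$).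
   Context: $V_0$: one-dimensional, $a,b,c$ act by $0$. $V_1$: basis $v_1,v_2,v_3$, $av_1=v_2$, $av_2=v_3$, $av_3=0$, $bv_1=0$, $bv_2=v_1$, $bv_3=v_2$, $cv_1=v_1$, $cv_2=0$, $cv_3=v_3$. $M$: basis $v_1..v_4,w_1..w_4$, $av_i=v_{i+1}$ ($i\le3$), $av_4=0$, $bv_1=bv_4=0$, $bv_i=v_{i-1}$ ($i=2,3$), $cv_i=v_i$ ($i=1,3$), $cv_i=0$ ($i=2,4$), $aw_i=w_{i+1}$ ($i\le3$), $aw_4=0$, $bw_i=v_{i+2}$ ($i=1,2$), $bw_i=w_{i-1}$ ($i=3,4$), $cw_i=0$ ($i=1,3$), $cw_i=w_i$ ($i=2,4$). $N$: basis $v_1..v_4,w_1..w_4$, $av_i=v_{i+1}$ ($i\le3$), $av_4=0$, $bv_i=0$ ($i=1,2$), $bv_i=v_{i-1}$ ($i=3,4$), $cv_i=0$ ($i=1,3$), $cv_i=v_i$ ($i=2,4$), $aw_i=w_{i+1}$ ($i\le3$), $aw_4=0$, $bw_i=v_i$ ($i=1,4$), $bw_i=v_i+w_{i-1}$ ($i=2,3$), $cw_i=w_i$ ($i=1,3$), $cw_i=0$ ($i=2,4$). String modules: each has a basis $z_1,\dots,z_d$ with $az_i=\kappa_i z_{i+1}$, $bz_i=\mu_i z_{i-1}$, $cz_i=\nu_i z_i$, where $\kappa_i,\mu_i,\nu_i\in\{0,1\}$, $\kappa_i=1$ and $\mu_i=1$ except for the listed indices where they are $0$, and $\nu_i$ is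 the residue mod 2 indicated (''$\nu_i\equiv i+1$'' or ''$\nu_i\equiv i$''): $\mathtt U_{1,r}$: $d=4r+1$; $\kappa_i=0$ iff $i\equiv0\ (4)$ or $i=4r+1$; $\mu_i=0$ iff $i\equiv2\ (4)$ or $i=1$; $\nu_i\equiv i+1$. $\mathtt U_{2,r}$: $d=4r+3$; $\kappa_i=0$ iff $i\equiv3\ (4)$; $\mu_i=0$ iff $i\equiv1\ (4)$; $\nu_i\equiv i$. $\mathtt U_{3,r}$: $d=4r+3$; $\kappa_i=0$ iff $i\equiv0\ (4)$ or $i=4r+3$; $\mu_i=0$ iff $i\equiv0\ (4)$ or $i=1$; $\nu_i\equiv i$. $\mathtt U_{4,r}$: $d=4r+1$; $\kappa_i=0$ iff $i\equiv1\ (4)$; $\mu_i=0$ iff $i\equiv1\ (4)$; $\nu_i\equiv i+1$. $\mathtt V_{1,t}$: $d=4(t+1)$; $\kappa_i=0$ iff $i\equiv0\ (4)$; $\mu_i=0$ iff $i\equiv2\ (4)$ or $i=1$; $\nu_i\equiv i+1$. $\mathtt V_{2,t}$: $d=4(t+1)$; $\kappa_i=0$ iff $i\equiv3\ (4)$ or $i=4(t+1)$; $\mu_i=0$ iff $i\equiv1\ (4)$; $\nu_i\equiv i$. $\mathtt W_{1,t}$: $d=4(t+1)$; $\kappa_i=0$ iff $i\equiv0\ (4)$ or $i=4(t+1)$; $\mu_i=0$ iff $i\equiv0\ (4)$ or $i=1$; $\nu_i\equiv i$. $\mathtt W_{2,t}$: $d=4(t+1)$; $\kappa_i=0$ iff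 $i\equiv1\ (4)$ or $i=4(t+1)$; $\mu_i=0$ iff $i\equiv1\ (4)$ or $i=1$; $\nu_i\equiv i+1$. Band modules: $\mathtt A_{\lambda,n}$ and $\mathtt B_{\lambda,n}$ have a basis $z_1,\dots,z_{4n}$ with $az_i=\kappa_iz_{i+1}$, $bz_i=\mu_iz_{i-1}+\xi_i\lambda z_{i+3}$, $cz_i=\nu_iz_i$, $\kappa_i,\mu_i,\xi_i,\nu_i\in\{0,1\}$, equal to $1$ except at listed indices: $\mathtt A_{\lambda,n}$: $\kappa_i=0$ iff $i\equiv0\ (4)$; $\mu_i=0$ iff $i\equiv2\ (4)$ or $i=1$; $\xi_i=0$ iff $i\equiv0,2,3\ (4)$; $\nu_i\equiv i+1$. $\mathtt B_{\lambda,n}$: $\kappa_i=0$ iff $i\equiv0\ (4)$; $\mu_i=0$ iff $i\equiv0\ (4)$ or $i=1$; $\xi_i=0$ iff $i\equiv0,2,3\ (4)$; $\nu_i\equiv i$. *)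

(* Defs.v *)
From HB Require Import structures.
From mathcomp Require Import all_boot all_order all_algebra.
Set Implicit Arguments. Unset Strict Implicit. Unset Printing Implicit Defensive.
Import GRing.Theory.
Local Open Scope ring_scope.

(* A finite-dimensional left module over u(m), given in coordinates: a vector
   space k^d (column vectors) with the actions of the generators a, b, c as
   d x d matrices (x |-> ua *m x). *)
Record umod (k : fieldType) := UMod {
  udim : nat;
  ua : 'M[k]_udim;
  ub : 'M[k]_udim;
  uc : 'M[k]_udim }.

Section UMod.
Variable k : fieldType.

Definition is_umod (X : umod k) : Prop :=
  [/\ ua X *m ub X + ub X *m ua X = uc X,
      ua X *m uc X + uc X *m ua X = ua X,
      ub X *m uc X + uc X *m ub X = ub X,
      ua X *m ua X *m ua X *m ua X = 0 &
      ub X *m ub X *m ub X *m ub X = 0 /\ uc X *m uc X + uc X = 0].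

Definition is_hom (X Y : umod k) (F : 'M[k]_(udim Y, udim X)) : Prop :=
  [/\ F *m ua X = ua Y *m F, F *m ub X = ub Y *m F & F *m uc X = uc Y *m F].

Definition umod_iso (X Y : umod k) : Prop :=
  exists (F : 'M[k]_(udim Y, udim X)) (G : 'M[k]_(udim X, udim Y)),
    [/\ is_hom F, is_hom G, G *m F = 1%:M & F *m G = 1%:M].

Definition dsum (X Y : umod k) : umod k :=
  @UMod k (udim X + udim Y)
    (block_mx (ua X) 0 0 (ua Y)) (block_mx (ub X) 0 0 (ub Y))
    (block_mx (uc X) 0 0 (uc Y)).

Definition indecomposable (X : umod k) : Prop :=
  (0 < udim X)%N /\
  forall Y Z : umod k, is_umod Y -> is_umod Z ->
    (0 < udim Y)%N -> (0 < udim Z)%N -> ~ umod_iso X (dsum Y Z).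

(* simple: nonzero, and every submodule (image of an injective hom) is 0 or everything *)
Definition simple_umod (S : umod k) : Prop :=
  [/\ is_umod S, (0 < udim S)%N &
    forall (X : umod k) (F : 'M[k]_(udim S, udim X)), is_umod X -> is_hom F ->
      \rank F = udim X -> udim X = 0%N \/ \rank F = udim S].

Definition projective_umod (P : umod k) : Prop :=
  is_umod P /\
  forall (X Y : umod k) (g : 'M[k]_(udim Y, udim X)) (f : 'M[k]_(udim Y, udim P)),
    is_umod X -> is_umod Y -> is_hom g -> \rank g = udim Y -> is_hom f ->
    exists h : 'M[k]_(udim X, udim P), is_hom h /\ g *m h = f.

Definition projective_cover (P V : umod k) : Prop :=
  projective_umod P /\ is_umod V /\
  exists p : 'M[k]_(udim V, udim P),
    [/\ is_hom p, \rank p = udim V &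
      forall (X : umod k) (h : 'M[k]_(udim P, udim X)), is_umod X -> is_hom h ->
        \rank (p *m h) = udim V -> \rank h = udim P].

(* d x d matrix with 1-based entries f row col *)
Definition mk_mx (d : nat) (f : nat -> nat -> k) : 'M[k]_d :=
  \matrix_(p < d, q < d) f p.+1 q.+1.

Definition b2k (b : bool) : k := if b then 1 else 0.

(* basis z_1..z_d, a z_i = kap_i z_(i+1), b z_i = mu_i z_(i-1) + xi_i lam z_(i+3),
   c z_i = nu_i z_i  (indices outside 1..d mean 0) *)
Definition gen_mod (d : nat) (kap mu nu xi : nat -> bool) (lam : k) : umod k :=
  @UMod k d
    (mk_mx d (fun p q => b2k ((p == q.+1) && kap q)))
    (mk_mx d (fun p q => b2k ((q == p.+1) && mu q) + (if (p == q + 3)%N && xi q then lam else 0)))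
    (mk_mx d (fun p q => b2k ((p == q) && nu q))).

Definition string_mod d kap mu nu := gen_mod d kap mu nu (fun _ => false) 0.

Definition nu_ev (i : nat) : bool := ~~ odd i.
Definition nu_od (i : nat) : bool := odd i.

Definition V0 : umod k := @UMod k 1 0 0 0.
Definition V1 : umod k :=
  string_mod 3 (fun i => (i < 3)%N) (fun i => (1 < i)%N) nu_od.

Definition aMN : 'M[k]_8 :=
  mk_mx 8 (fun p q => b2k ((p == q.+1) && (q \in [:: 1; 2; 3; 5; 6; 7]%N))).
(* v_i = z_i (i=1..4), w_i = z_(i+4) *)
Definition Mmod : umod k :=
  @UMod k 8 aMN
    (mk_mx 8 (fun p q => b2k ((p, q) \in [:: (1,2); (2,3); (3,5); (4,6); (6,7); (7,8)]%N)))
    (mk_mx 8 (fun p q => b2k ((p == q) && (q \in [:: 1; 3; 6; 8]%N)))).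
Definition Nmod : umod k :=
  @UMod k 8 aMN
    (mk_mx 8 (fun p q => b2k ((p, q) \in
        [:: (2,3); (3,4); (1,5); (4,8); (2,6); (5,6); (3,7); (6,7)]%N)))
    (mk_mx 8 (fun p q => b2k ((p == q) && (q \in [:: 2; 4; 5; 7]%N)))).

Definition U1 (r : nat) : umod k :=
  let d := (4 * r + 1)%N in
  string_mod d (fun i => ~~ ((i %% 4 == 0) || (i == d))%N)
               (fun i => ~~ ((i %% 4 == 2) || (i == 1))%N) nu_ev.
Definition U2 (r : nat) : umod k :=
  let d := (4 * r + 3)%N in
  string_mod d (fun i => ~~ (i %% 4 == 3)%N) (fun i => ~~ (i %% 4 == 1)%N) nu_od.
Definition U3 (r : nat) : umod k :=
  let d := (4 * r + 3)%N in
  string_mod d (fun i => ~~ ((i %% 4 == 0) || (i == d))%N)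
               (fun i => ~~ ((i %% 4 == 0) || (i == 1))%N) nu_od.
Definition U4 (r : nat) : umod k :=
  let d := (4 * r + 1)%N in
  string_mod d (fun i => ~~ (i %% 4 == 1)%N) (fun i => ~~ (i %% 4 == 1)%N) nu_ev.
Definition Umod (i r : nat) : umod k :=
  match i with 1 => U1 r | 2 => U2 r | 3 => U3 r | _ => U4 r end.

Definition Vs1 (t : nat) : umod k :=
  let d := (4 * t.+1)%N in
  string_mod d (fun i => ~~ (i %% 4 == 0)%N)
               (fun i => ~~ ((i %% 4 == 2) || (i == 1))%N) nu_ev.
Definition Vs2 (t : nat) : umod k :=
  let d := (4 * t.+1)%N in
  string_mod d (fun i => ~~ ((i %% 4 == 3) || (i == d))%N)
               (fun i => ~~ (i %% 4 == 1)%N) nu_od.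
Definition W1 (t : nat) : umod k :=
  let d := (4 * t.+1)%N in
  string_mod d (fun i => ~~ ((i %% 4 == 0) || (i == d))%N)
               (fun i => ~~ ((i %% 4 == 0) || (i == 1))%N) nu_od.
Definition W2 (t : nat) : umod k :=
  let d := (4 * t.+1)%N in
  string_mod d (fun i => ~~ ((i %% 4 == 1) || (i == d))%N)
               (fun i => ~~ ((i %% 4 == 1) || (i == 1))%N) nu_ev.
Definition Vmod (j t : nat) : umod k := if j == 1%N then Vs1 t else Vs2 t.
Definition Wmod (j t : nat) : umod k := if j == 1%N then W1 t else W2 t.

Definition xi_band (i : nat) : bool := (i %% 4 == 1)%N.
Definition Aband (lam : k) (n : nat) : umod k :=
  gen_mod (4 * n) (fun i => ~~ (i %% 4 == 0)%N)
          (fun i => ~~ ((i %% 4 == 2) || (i == 1))%N) nu_ev xi_band lam.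
Definition Bband (lam : k) (n : nat) : umod k :=
  gen_mod (4 * n) (fun i => ~~ (i %% 4 == 0)%N)
          (fun i => ~~ ((i %% 4 == 0) || (i == 1))%N) nu_od xi_band lam.

Definition in_list (X : umod k) : Prop :=
  [\/ [\/ umod_iso X V0, umod_iso X V1, umod_iso X Mmod | umod_iso X Nmod],
      exists i r, [/\ (1 <= i <= 4)%N, (1 <= r)%N & umod_iso X (Umod i r)],
      exists j t, (1 <= j <= 2)%N /\ (umod_iso X (Vmod j t) \/ umod_iso X (Wmod j t)) |
      exists (lam : k) n, [/\ lam != 0, (1 <= n)%N &
                            umod_iso X (Aband lam n) \/ umod_iso X (Bband lam n)]].

End UMod.

(* Main.v *)
(* On ker c the operators P = a^2, Q = b^2 and T = ab = ba satisfy T^2 + T = PQ, and T^2 is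
   idempotent.  So ker c is a module over the basic algebra of u(m), which is k[P,Q]/(P^2,Q^2)
   graded by Z/2, and it determines the whole module; the two graded pieces Y0, Y1 count the
   composition factors V0, V1.  If PQ is nonzero on an indecomposable graded module, the module
   is free of rank one (giving M or N); otherwise its radical square is zero and it is a
   Kronecker pencil Y0 -> Y1 or Y1 -> Y0.  A pencil (A, B) with A not onto is treated by
   induction, splitting off the cokernel of A; the transposed case follows by duality, and if A
   is invertible an eigenvalue of A^-1 B reduces to the first case. *)
Require Import Defs.
From HB Require Import structures.
From mathcomp Require Import all_boot all_order all_algebra.
From mathcomp Require Import zify ring.
Set Implicit Arguments. Unset Strict Implicit. Unset Printing Implicit Defensive.
Import GRing.Theory.
Local Open Scope ring_scope.

(** Indecomposability is handled throughout as the absence of idempotent endomorphisms other than 0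
    and 1; [graded_indec] and [pencil_indec] state this for the smaller data. Each reduction
    therefore only has to exhibit a commuting idempotent, and the same equivalences serve both for
    the completeness of the list and for the indecomposability of its members.

    The part ker c determines the module for the following reason. The summand [Y1] is where
    [T^2 = 1], hence [T = 1 + PQ] there; [Y0] is where [T^2 = 0], hence [T = PQ] there. On im c the
    relation [ab + ba = c] reads [z = a (b z) + b (a z)], and for [y] in [Y0] it gives
    [a y = b (P y)] and [b y = a (Q y)]. So im c is [a Y1 + b Y1], two copies of [Y1], and [a], [b]
    are known on it through [P], [Q] and [T].

    Strings and bands are the four combinations of a direction of the pencil, [Y0 -> Y1] or
    [Y1 -> Y0], with a normal form: [T2] when the first map is not onto, [T1] when it is. *)

(** * Deciding identities in u(m) *)

(* The letters 0, 1, 2 stand for a, b, c, a list of letters for a word, and a list of words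
   for its sum over F_2.  Words are rewritten to the PBW basis a^i b^j c^l by multiplying
   basis words by generators on the left. *)
Fixpoint cmul_word (w : seq nat) : seq (seq nat) :=
  match w with
  | [::] => [:: [:: 2]]
  | 0 :: u => (0 :: u) :: map (cons 0) (cmul_word u)
  | 1 :: u => (1 :: u) :: map (cons 1) (cmul_word u)
  | g :: u => [:: g :: u]
  end%N.

Definition amul_word (w : seq nat) : seq (seq nat) :=
  if w is [:: 0, 0, 0 & _]%N then [::] else [:: 0%N :: w].

Fixpoint bmul_word (w : seq nat) : seq (seq nat) :=
  match w with
  | 0 :: u => flatten (map amul_word (bmul_word u)) ++ cmul_word u
  | [:: 1, 1, 1 & _] => [::]
  | _ => [:: 1 :: w]
  end%N.

Definition lmul (g : nat) : seq nat -> seq (seq nat) :=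
  match g with 0 => amul_word | 1 => bmul_word | _ => cmul_word end%N.

Definition toggle (w : seq nat) (p : seq (seq nat)) :=
  if w \in p then rem w p else w :: p.

Definition nf_word (w : seq nat) : seq (seq nat) :=
  foldr (fun g p => foldr toggle [::] (flatten (map (lmul g) p))) [:: [::]] w.

Definition nf (p : seq (seq nat)) : seq (seq nat) :=
  foldr toggle [::] (flatten (map nf_word p)).

Definition pmul (p q : seq (seq nat)) : seq (seq nat) :=
  flatten [seq [seq u ++ v | v <- q] | u <- p].

Section Eval.
Variables (k : fieldType).
Hypothesis char2 : (2 \in [pchar k])%N.

Lemma addmx_char2 m n (A : 'M[k]_(m, n)) : A + A = 0.
Proof. by apply/matrixP=> i j; rewrite !mxE addrr_pchar2. Qed.

Lemma oppmx_char2 m n (A : 'M[k]_(m, n)) : - A = A.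
Proof. by apply/eqP; rewrite eq_sym -addr_eq0 addmx_char2. Qed.

Definition letter (X : umod k) (g : nat) : 'M[k]_(udim X) :=
  match g with 0 => ua X | 1 => ub X | _ => uc X end%N.

Definition wval (X : umod k) (w : seq nat) : 'M[k]_(udim X) :=
  foldr (fun g A => letter X g *m A) 1%:M w.

Definition pval (X : umod k) (p : seq (seq nat)) : 'M[k]_(udim X) :=
  \sum_(w <- p) wval X w.

Lemma pval_cat X p q : pval X (p ++ q) = pval X p + pval X q.
Proof. exact: big_cat. Qed.

Lemma pval_cons X w p : pval X (w :: p) = wval X w + pval X p.
Proof. exact: big_cons. Qed.

Lemma pval_nil X : pval X [::] = 0.
Proof. exact: big_nil. Qed.

Lemma pval1 X w : pval X [:: w] = wval X w.
Proof. by rewrite pval_cons pval_nil addr0. Qed.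

Lemma wval_cat X u v : wval X (u ++ v) = wval X u *m wval X v.
Proof. by elim: u => [|g u IH] /=; rewrite ?mul1mx // IH mulmxA. Qed.

Lemma pval_mul X p q : pval X (pmul p q) = pval X p *m pval X q.
Proof.
elim: p => [|u p IH]; first by rewrite !pval_nil mul0mx.
rewrite /pmul /= pval_cat pval_cons mulmxDl -IH; congr (_ + _).
elim: q {IH} => [|v q IH]; first by rewrite !pval_nil mulmx0.
by rewrite /= !pval_cons IH mulmxDr wval_cat.
Qed.

Lemma pval_flatten X (f : seq nat -> seq (seq nat)) (A : 'M_(udim X)) p :
    (forall w, pval X (f w) = A *m wval X w) ->
  pval X (flatten (map f p)) = A *m pval X p.
Proof.
move=> fE; elim: p => [|w p IH]; first by rewrite !pval_nil mulmx0.
by rewrite /= pval_cat pval_cons fE IH mulmxDr.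
Qed.

Lemma pval_map_cons X g p : pval X (map (cons g) p) = letter X g *m pval X p.
Proof.
elim: p => [|w p IH]; first by rewrite !pval_nil mulmx0.
by rewrite /= !pval_cons IH mulmxDr.
Qed.

Lemma pval_toggle X w p : pval X (toggle w p) = wval X w + pval X p.
Proof.
rewrite /toggle; case: ifP => [wp|_]; last exact: pval_cons.
rewrite [in RHS]/pval (perm_big _ (perm_to_rem wp)) -/(pval _ _) pval_cons.
by rewrite addrA addmx_char2 add0r.
Qed.

Lemma pval_reduce X p : pval X (foldr toggle [::] p) = pval X p.
Proof. by elim: p => //= w p IH; rewrite pval_toggle IH pval_cons. Qed.

Section Correct.
Variable X : umod k.
Hypothesis uX : is_umod X.

Lemma cmul_wordP w : pval X (cmul_word w) = uc X *m wval X w.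
Proof.
have [_ ac bc _ [_ cc]] := uX.
have com A : A *m uc X + uc X *m A = A -> uc X *m A = A + A *m uc X.
  by move=> E; rewrite -[X in X + _]E addrAC addmx_char2 add0r.
elim: w => [|[|[|g]] u IH] /=; rewrite ?pval1 // ?pval_cons ?pval_nil.
- by rewrite pval_map_cons IH !mulmxA /= (com _ ac) mulmxDl.
- by rewrite pval_map_cons IH !mulmxA /= (com _ bc) mulmxDl.
- rewrite mulmxA; congr (_ *m _) => /=.
  by apply/eqP; rewrite -subr_eq0 oppmx_char2 addrC cc.
Qed.

Lemma amul_wordP w : pval X (amul_word w) = ua X *m wval X w.
Proof.
have [_ _ _ a4 _] := uX.
case: w => [|[|g] [|[|g'] [|[|g''] u]]] //=; rewrite ?pval1 //.
by rewrite pval_nil !mulmxA a4 mul0mx.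
Qed.

Lemma bmul_wordP w : pval X (bmul_word w) = ub X *m wval X w.
Proof.
have [ab _ _ _ [b4 _]] := uX.
elim: w => [|g u IH]; first by rewrite pval1.
case: g => [|[|g]]; last by rewrite pval1.
  rewrite /= pval_cat (pval_flatten _ amul_wordP) IH cmul_wordP !mulmxA -mulmxDl.
  by rewrite -ab addrA addmx_char2 add0r.
case: u {IH} => [|[|[|?]] [|[|[|?]] u]]; rewrite ?pval1 //=.
by rewrite pval_nil !mulmxA b4 mul0mx.
Qed.

Lemma lmulP g w : pval X (lmul g w) = letter X g *m wval X w.
Proof. by case: g => [|[|g]]; [apply: amul_wordP|apply: bmul_wordP|apply: cmul_wordP]. Qed.

Lemma nf_wordP w : pval X (nf_word w) = wval X w.
Proof.
elim: w => [|g w IH]; first by rewrite pval1.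
by rewrite /= pval_reduce (pval_flatten _ (lmulP g)) IH.
Qed.

Lemma nfP p : pval X (nf p) = pval X p.
Proof.
rewrite /nf pval_reduce -[RHS]mul1mx; apply: pval_flatten => w.
by rewrite nf_wordP mul1mx.
Qed.

(** This is how every identity of the algebra is obtained below: the sum of both sides is reduced by
    computation, and in characteristic 2 a vanishing sum is an equality. It holds in any module,
    since each rewriting step is one of the relations. *)
Lemma pval_eq p q : nf (p ++ q) = [::] -> pval X p = pval X q.
Proof.
move=> E; have := nfP (p ++ q); rewrite E pval_nil pval_cat => /eqP.
by rewrite eq_sym addr_eq0 oppmx_char2 => /eqP.
Qed.

End Correct.
End Eval.

(** * Reduction to graded modules over the basic algebra *)

Section Iso.
Variable k : fieldType.
Implicit Types X Y Z : umod k.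

Lemma hom_comp X Y Z (F : 'M_(udim Y, udim X)) (G : 'M_(udim Z, udim Y)) :
  is_hom F -> is_hom G -> is_hom (G *m F : 'M_(udim Z, udim X)).
Proof.
move=> [Fa Fb Fc] [Ga Gb Gc]; split.
- by rewrite -mulmxA Fa !mulmxA Ga.
- by rewrite -mulmxA Fb !mulmxA Gb.
- by rewrite -mulmxA Fc !mulmxA Gc.
Qed.

Lemma hom_pval X Y (F : 'M_(udim Y, udim X)) p :
  is_hom F -> F *m pval X p = pval Y p *m F.
Proof.
move=> [Fa Fb Fc].
have Fw w : F *m wval X w = wval Y w *m F.
  elim: w => [|g w IH] /=; first by rewrite mulmx1 mul1mx.
  by rewrite -mulmxA -IH !mulmxA; case: g => [|[|g]]; rewrite /= ?Fa ?Fb ?Fc.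
elim: p => [|w p IH]; first by rewrite !pval_nil mulmx0 mul0mx.
by rewrite !pval_cons mulmxDr mulmxDl IH Fw.
Qed.

Lemma iso_intro X Y (F : 'M_(udim Y, udim X)) (G : 'M_(udim X, udim Y)) :
  is_hom F -> G *m F = 1%:M -> F *m G = 1%:M -> umod_iso X Y.
Proof.
move=> homF GF FG; exists F, G; split=> //; have [Fa Fb Fc] := homF.
split; rewrite -[LHS]mulmx1 -FG mulmxA -[X in X *m G]mulmxA.
- by rewrite -Fa mulmxA GF mul1mx.
- by rewrite -Fb mulmxA GF mul1mx.
- by rewrite -Fc mulmxA GF mul1mx.
Qed.

Lemma iso_sym X Y : umod_iso X Y -> umod_iso Y X.
Proof. by case=> F [G [*]]; exists G, F. Qed.

Lemma iso_trans X Y Z : umod_iso X Y -> umod_iso Y Z -> umod_iso X Z.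
Proof.
move=> [F [G [hF hG GF FG]]] [F' [G' [hF' hG' GF' FG']]].
apply: (iso_intro (hom_comp hF hF') (G := G *m G')).
  by rewrite -mulmxA [G' *m _]mulmxA GF' mul1mx.
by rewrite -mulmxA [F *m _]mulmxA FG mul1mx.
Qed.

Lemma iso_umod X Y : umod_iso X Y -> is_umod Y -> is_umod X.
Proof.
move=> [F [G [[Fa Fb Fc] _ GF FG]]] [ab ac bc a4 [b4 cc]].
have tr (A : 'M_(udim X)) B : F *m A = B *m F -> A = G *m B *m F.
  by move=> E; rewrite -mulmxA -E mulmxA GF mul1mx.
have mulc B C : G *m B *m F *m (G *m C *m F) = G *m (B *m C) *m F.
  by rewrite -!mulmxA [F *m _]mulmxA FG mul1mx.
rewrite /is_umod (tr _ _ Fa) (tr _ _ Fb) (tr _ _ Fc) !mulc -!mulmxDl -!mulmxDr.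
by rewrite ab ac bc a4 b4 cc !mulmx0 !mul0mx.
Qed.

Lemma iso_indecomposable X Y :
  umod_iso X Y -> indecomposable Y -> indecomposable X.
Proof.
move=> XY [Y0 Yind]; split.
  rewrite lt0n; apply/eqP => X0.
  have [F [G [_ _ _ FG]]] := XY.
  have : \rank (F *m G) = udim Y by rewrite FG mxrank1.
  have := mxrankM_maxl F G; have := rank_leq_col F; lia.
move=> Z Z' uZ uZ' Z0 Z'0 XZ; apply: (Yind Z Z') => //.
exact: iso_trans (iso_sym XY) XZ.
Qed.

End Iso.

(** Rank factorization: in [E = i p] the factor [i] cancels on the left and [p] on the right, so
    [E E = E] becomes [p i = 1]. *)
Lemma split_idempotent (k : fieldType) d (E : 'M[k]_d) : E *m E = E ->
  exists n (i : 'M[k]_(d, n)) (p : 'M[k]_(n, d)),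
    p *m i = 1%:M /\ i *m p = E.
Proof.
move=> EE; exists (\rank E), (col_base E), (row_base E); split; last exact: mulmx_base.
apply: (row_full_inj (col_base_full E)); apply: (row_free_inj (row_base_free E)).
by rewrite mulmx1 mulmxA mulmx_base -mulmxA mulmx_base.
Qed.

(* The basic algebra of u(m) is the Z/2-graded algebra k[P,Q]/(P^2,Q^2); a graded
   module over it is a pair of spaces (Y0, Y1) with P, Q acting by p01, q01 : Y0 -> Y1 and
   p10, q10 : Y1 -> Y0. *)
Definition graded_rel (k : fieldType) n0 n1
    (p01 q01 : 'M[k]_(n1, n0)) (p10 q10 : 'M[k]_(n0, n1)) :=
  [/\ p10 *m p01 = 0 /\ p01 *m p10 = 0, q10 *m q01 = 0 /\ q01 *m q10 = 0,
      q10 *m p01 = p10 *m q01 & q01 *m p10 = p01 *m q10].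

(* The u(m)-module Y0 + Y1 + a Y1 + b Y1, where the first two summands form ker c and the
   last two im c; there P = a^2, Q = b^2, and T is the action of ab = ba on Y1. *)
Definition Phi (k : fieldType) n0 n1
    (p01 q01 : 'M[k]_(n1, n0)) (p10 q10 : 'M[k]_(n0, n1)) : umod k :=
  let T := 1%:M + p01 *m q10 in
  @UMod k ((n0 + n1) + (n1 + n1))
    (block_mx 0 (block_mx p10 0 0 T) (block_mx 0 1%:M p01 0) 0)
    (block_mx 0 (block_mx 0 q10 T 0) (block_mx q01 0 0 1%:M) 0)
    (block_mx 0 0 0 1%:M).

(** * The module built from a graded module satisfies the relations *)

Section Phi.
Variable k : fieldType.
Hypothesis char2 : (2 \in [pchar k])%N.

Let addmm := addmx_char2 char2.

Section Rel.
Variables (n0 n1 : nat) (p01 q01 : 'M[k]_(n1, n0)) (p10 q10 : 'M[k]_(n0, n1)).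
Hypothesis rel : graded_rel p01 q01 p10 q10.

Let T := 1%:M + p01 *m q10.

(** [T] differs from 1 by [PQ], which a further [P] or [Q] kills on either side; so [T] disappears
    next to each of the four maps, here and in the next three lemmas. *)
Lemma T_p01 : T *m p01 = p01.
Proof.
have [[_ pp] _ qp _] := rel.
by rewrite mulmxDl mul1mx -mulmxA qp mulmxA pp mul0mx addr0.
Qed.

Lemma T_q01 : T *m q01 = q01.
Proof.
have [_ [qq _] _ _] := rel.
by rewrite mulmxDl mul1mx -mulmxA qq mulmx0 addr0.
Qed.

Lemma p10_T : p10 *m T = p10.
Proof.
have [[pp _] _ _ _] := rel.
by rewrite mulmxDr mulmx1 mulmxA pp mul0mx addr0.
Qed.

Lemma q10_T : q10 *m T = q10.
Proof.
have [_ [_ qq] pq _] := rel.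
by rewrite mulmxDr mulmx1 mulmxA pq -mulmxA qq mulmx0 addr0.
Qed.

Lemma T_T : T *m T = 1%:M.
Proof.
rewrite {2}/T mulmxDr mulmx1 mulmxA T_p01 /T -addrA addmm addr0 //.
Qed.

Lemma Phi_umod : is_umod (Phi p01 q01 p10 q10).
Proof.
have [[pp pp'] [qq qq'] qp pq] := rel.
have bm := mulmx_block.
rewrite /is_umod /= -/T !bm ?(mul0mx, mulmx0, mul1mx, mulmx1, add0r, addr0).
rewrite ?(T_p01, T_q01, p10_T, q10_T, T_T).
rewrite ?bm ?(mul0mx, mulmx0, mul1mx, mulmx1, add0r, addr0).
rewrite ?(T_p01, T_q01, p10_T, q10_T, T_T, pp, qq, pp', qq').
rewrite ?bm ?(mul0mx, mulmx0, mul1mx, mulmx1, add0r, addr0, T_T).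
rewrite ?(T_p01, T_q01, p10_T, q10_T, T_T, pp, qq, pp', qq').
rewrite ?(add_block_mx, add0r, addr0, addmm, qp, pq).
have TT : T + p01 *m q10 = 1%:M by rewrite /T -addrA addmm addr0.
rewrite TT [_ + T]addrC TT.
by rewrite ?(block_mx0, mul0mx, mulmx0, addmm, scalar_mx_block).
Qed.

End Rel.

End Phi.

(** * Direct summands and idempotent endomorphisms *)

Section Idempotents.
Variable k : fieldType.
Implicit Types X Y Z : umod k.

(** The summand cut out by the endomorphism [i *m p], in coordinates of its image. *)
Definition retract X n (i : 'M_(udim X, n)) (p : 'M_(n, udim X)) : umod k :=
  @UMod k n (p *m ua X *m i) (p *m ub X *m i) (p *m uc X *m i).

Lemma retract_umod X n (i : 'M_(udim X, n)) (p : 'M_(n, udim X)) :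
    is_umod X -> p *m i = 1%:M -> is_hom (i *m p : 'M_(udim X, udim X)) ->
  is_umod (retract i p).
Proof.
move=> [ab ac bc a4 [b4 cc]] pi [Fa Fb Fc].
have mul A B : i *m p *m B = B *m (i *m p) ->
    p *m A *m i *m (p *m B *m i) = p *m (A *m B) *m i.
  move=> FB; rewrite -!mulmxA; congr (p *m (A *m _)).
  by rewrite mulmxA [LHS]mulmxA FB -!mulmxA pi mulmx1.
rewrite /is_umod /= !mul // -!mulmxDl -!mulmxDr ab ac bc a4 b4 cc.
by rewrite !mulmx0 !mul0mx.
Qed.

(** Otherwise [X] would be the sum of the images of [F] and [1 - F], both nonzero; [col_mx p p'] is
    the isomorphism. *)
Lemma indecomposable_idempotent X (F : 'M_(udim X)) :
    is_umod X -> indecomposable X -> is_hom (F : 'M_(udim X, udim X)) ->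
    F *m F = F ->
  F = 0 \/ F = 1%:M.
Proof.
move=> uX [_ indX] homF FF; pose F' := 1%:M - F.
have F'F' : F' *m F' = F'.
  by rewrite {2}/F' mulmxBr mulmx1 mulmxBl mul1mx FF subrr subr0.
have homF' : is_hom (F' : 'M_(udim X, udim X)).
  by case: homF => Fa Fb Fc; split; rewrite mulmxBl mulmxBr mulmx1 mul1mx ?Fa ?Fb ?Fc.
have [n [i [p [pi ip]]]] := split_idempotent FF.
have [n' [i' [p' [pi' ip']]]] := split_idempotent F'F'.
case: (posnP n) => [n_eq0|n0].
  by left; subst n; rewrite -ip [p]flatmx0 mulmx0.
case: (posnP n') => [n'_eq0|n'0].
  subst n'; right; apply/eqP; rewrite eq_sym -subr_eq0 -/F' -ip'.
  by rewrite [p']flatmx0 mulmx0.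
exfalso; apply: (indX (retract i p) (retract i' p')) => //.
- by apply: retract_umod; rewrite // ip.
- by apply: retract_umod; rewrite // ip'.
have pE : p = p *m F by rewrite -ip mulmxA pi mul1mx.
have p'E : p' = p' *m F' by rewrite -ip' mulmxA pi' mul1mx.
have pi'0 : p *m i' = 0.
  rewrite -[i']mulmx1 -pi' [i' *m _]mulmxA ip' pE mulmxA -[p *m F *m F']mulmxA.
  by rewrite mulmxBr mulmx1 FF subrr mulmx0 mul0mx.
have p'i0 : p' *m i = 0.
  rewrite -[i]mulmx1 -pi [i *m _]mulmxA ip p'E mulmxA -[p' *m F' *m F]mulmxA.
  by rewrite mulmxBl mul1mx FF subrr mulmx0 mul0mx.
have com B : F *m B = B *m F -> p *m B = p *m B *m i *m p.
  by move=> FB; rewrite -[RHS]mulmxA ip -mulmxA -FB mulmxA -pE.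
have com' B : F *m B = B *m F -> p' *m B = p' *m B *m i' *m p'.
  move=> FB; rewrite -[RHS]mulmxA ip' -mulmxA.
  have <- : F' *m B = B *m F' by rewrite mulmxBl mulmxBr mulmx1 mul1mx FB.
  by rewrite mulmxA -p'E.
case: homF => Fa Fb Fc.
pose H : 'M_(udim (dsum (retract i p) (retract i' p')), udim X) := col_mx p p'.
apply: (@iso_intro _ _ _ H (row_mx i i')).
- split; rewrite /H /= mul_block_col mul_col_mx !mul0mx addr0 add0r.
  + by rewrite -(com _ Fa) -(com' _ Fa).
  + by rewrite -(com _ Fb) -(com' _ Fb).
  + by rewrite -(com _ Fc) -(com' _ Fc).
- by rewrite /H mul_row_col ip ip' addrC subrK.
- by rewrite /H mul_col_row pi pi' pi'0 p'i0 -scalar_mx_block.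
Qed.

(** A decomposition carries the projection onto its first summand back to [X], and this is neither 0
    nor 1 because both summands are nonzero. *)
Lemma idempotent_indecomposable X : (0 < udim X)%N ->
    (forall F : 'M_(udim X), is_hom (F : 'M_(udim X, udim X)) -> F *m F = F ->
      F = 0 \/ F = 1%:M) ->
  indecomposable X.
Proof.
move=> X0 idX; split=> // Y Z uY uZ Y0 Z0 [F [G [homF homG GF FG]]].
pose E : 'M[k]_(udim (dsum Y Z), udim (dsum Y Z)) := block_mx 1%:M 0 0 0.
have homE : is_hom E.
  by split; rewrite /E /= !mulmx_block ?(mul0mx, mulmx0, mul1mx, mulmx1, addr0).
have EE : E *m E = E.
  by rewrite /E !mulmx_block ?(mul0mx, mulmx0, mul1mx, mulmx1, addr0).
have back : E = F *m (G *m E *m F) *m G.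
  by rewrite !mulmxA FG mul1mx -mulmxA FG mulmx1.
case: (idX (G *m E *m F)).
- exact: hom_comp homF (hom_comp homE homG).
- by rewrite -!mulmxA [F *m _]mulmxA FG mul1mx [E *m _]mulmxA EE.
- move=> E0; move: back; rewrite E0 mulmx0 mul0mx.
  move=> /matrixP /(_ (lshift _ (Ordinal Y0)) (lshift _ (Ordinal Y0))).
  by rewrite block_mxEul !mxE eqxx => /eqP; rewrite oner_eq0.
- move=> E1; move: back; rewrite E1 mulmx1 FG.
  move=> /matrixP /(_ (rshift _ (Ordinal Z0)) (rshift _ (Ordinal Z0))).
  by rewrite block_mxEdr !mxE eqxx => /eqP; rewrite eq_sym oner_eq0.
Qed.

End Idempotents.

(** * Modules over u(m) against graded modules *)

Section GradedModules.
Variable k : fieldType.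
Hypothesis char2 : (2 \in [pchar k])%N.
Let addmm := addmx_char2 char2.

Definition graded_indec n0 n1 (p01 q01 : 'M[k]_(n1, n0)) (p10 q10 : 'M[k]_(n0, n1)) :=
  (0 < n0 + n1)%N /\
  forall (F0 : 'M_n0) (F1 : 'M_n1), F0 *m F0 = F0 -> F1 *m F1 = F1 ->
    F1 *m p01 = p01 *m F0 -> F1 *m q01 = q01 *m F0 ->
    F0 *m p10 = p10 *m F1 -> F0 *m q10 = q10 *m F1 ->
  (F0 = 0 /\ F1 = 0) \/ (F0 = 1%:M /\ F1 = 1%:M).

Lemma graded_indec_swap n0 n1 (p01 q01 : 'M[k]_(n1, n0)) (p10 q10 : 'M[k]_(n0, n1)) :
  graded_indec p01 q01 p10 q10 -> graded_indec p10 q10 p01 q01.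
Proof.
move=> [n_gt0 ind]; split; first by rewrite addnC.
by move=> F0 F1 *; case: (ind F1 F0) => // -[]; [left|right].
Qed.

Section Rel.
Variables (n0 n1 : nat) (p01 q01 : 'M[k]_(n1, n0)) (p10 q10 : 'M[k]_(n0, n1)).
Hypothesis rel : graded_rel p01 q01 p10 q10.
Let T := 1%:M + p01 *m q10.
Let PX := Phi p01 q01 p10 q10.

(** Commuting with [c] separates ker c from im c, and commuting with [a] and [b] expresses the
    blocks on im c through those on ker c. It remains to see that no component mixes [Y0] and
    [Y1]. *)
Lemma Phi_end (F : 'M_(udim PX)) : is_hom (F : 'M_(udim PX, udim PX)) ->
  exists (F0 : 'M_n0) (F1 : 'M_n1),
   [/\ F = block_mx (block_mx F0 0 0 F1) 0 0 (block_mx F1 0 0 F1),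
       F1 *m p01 = p01 *m F0, F1 *m q01 = q01 *m F0,
       F0 *m p10 = p10 *m F1 & F0 *m q10 = q10 *m F1].
Proof.
have [[pp pp'] [qq qq'] qp pq] := rel.
have simp := (mul0mx, mulmx0, mul1mx, mulmx1, add0r, addr0).
rewrite /PX /Phi /= -/T => -[/=].
rewrite -[F]submxK -[ulsubmx F]submxK -[drsubmx F]submxK.
move: (ulsubmx (ulsubmx F)) (ursubmx (ulsubmx F))
  (dlsubmx (ulsubmx F)) (drsubmx (ulsubmx F)) => F0 g1 g2 F1.
move: (ulsubmx (drsubmx F)) (ursubmx (drsubmx F))
  (dlsubmx (drsubmx F)) (drsubmx (drsubmx F)) => h1 h2 h3 h4.
move: (ursubmx F) (dlsubmx F) => u v.
rewrite !mulmx_block !simp.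
case/eq_block_mx=> _ aul aur _; case/eq_block_mx: aul => f0p g1T _ _.
case/eq_block_mx: aur => g2E h1E h4p h3E.
case/eq_block_mx=> _ bul bur _; case/eq_block_mx: bul => _ f0q _ _.
case/eq_block_mx: bur => h1q h2E _ h4E.
case/eq_block_mx=> _ u0 v0 _; subst u v h1 h4.
(* The equations give [g1 T = p10 q01 g1]. As [T^2 = 1], using this twice yields
   [g1 = p10 q01 p10 q01 g1], which is 0 by [q01 p10 = p01 q10] and [p10 p01 = 0]. *)
have g10 : g1 = 0.
  rewrite -[g1]mulmx1 -(T_T char2 rel) mulmxA g1T h2E -mulmxA -mulmxA g1T h2E.
  by rewrite [q01 *m (p10 *m _)]mulmxA pq !mulmxA pp !mul0mx.
subst g1; rewrite h2E mulmx0 mul0mx in g2E; subst g2 h2 h3.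
by exists F0, F1; rewrite !mulmx0.
Qed.

Lemma Phi_indec : graded_indec p01 q01 p10 q10 -> indecomposable PX.
Proof.
move=> [n_gt0 ind]; apply: idempotent_indecomposable.
  by rewrite /=; move: n_gt0; case: (n0) (n1) => [|?] [].
move=> F /Phi_end[F0 [F1 [-> p1 q1 p0 q0]]].
rewrite !mulmx_block !(mul0mx, mulmx0, add0r, addr0).
case/eq_block_mx; case/eq_block_mx=> F00 _ _ F11 _ _ _.
case: (ind F0 F1) => // -[-> ->]; [left|right]; last by rewrite -!scalar_mx_block.
by rewrite !block_mx0.
Qed.

Lemma graded_indec_of_Phi : indecomposable PX -> graded_indec p01 q01 p10 q10.
Proof.
move=> indP; split.
  by case: indP => + _; rewrite /=; case: (n0) (n1) => [|?] [].
move=> F0 F1 F00 F11 p1 q1 p0 q0.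
have TF1 : T *m F1 = F1 *m T.
  by rewrite mulmxDr mulmxDl mulmx1 mul1mx mulmxA p1 -!mulmxA q0.
have simp := (mul0mx, mulmx0, mul1mx, mulmx1, add0r, addr0).
pose F : 'M[k]_(udim PX) := block_mx (block_mx F0 0 0 F1) 0 0 (block_mx F1 0 0 F1).
have := @indecomposable_idempotent _ PX F (Phi_umod char2 rel) indP.
case.
- by split; rewrite /F /= -/T !mulmx_block !simp ?p1 ?q1 ?p0 ?q0 ?TF1.
- by rewrite /F !mulmx_block !simp F00 F11.
- rewrite -[0 in X in X -> _]submxK /F => /eq_block_mx[].
  rewrite -[X in _ = X -> _]submxK => /eq_block_mx[-> _ _ ->] _ _ _; left.
  by split; apply/matrixP=> i j; rewrite !mxE.
- rewrite /F scalar_mx_block !(@scalar_mx_block _ _ _ 1).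
  by case/eq_block_mx; case/eq_block_mx=> -> _ _ -> _ _ _; right.
Qed.

End Rel.

(** Functoriality: [S0] acts on [Y0] and [S1] on all three copies of [Y1], and the hypotheses make
    it intertwine the two operators [T]. *)
Lemma Phi_iso m0 m1 n0 n1 (p01 q01 : 'M[k]_(n1, n0)) (p10 q10 : 'M[k]_(n0, n1))
    (p01' q01' : 'M[k]_(m1, m0)) (p10' q10' : 'M[k]_(m0, m1))
    (S0 : 'M_(m0, n0)) (S0' : 'M_(n0, m0)) (S1 : 'M_(m1, n1)) (S1' : 'M_(n1, m1)) :
    S0' *m S0 = 1%:M -> S0 *m S0' = 1%:M -> S1' *m S1 = 1%:M -> S1 *m S1' = 1%:M ->
    S1 *m p01 = p01' *m S0 -> S1 *m q01 = q01' *m S0 ->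
    S0 *m p10 = p10' *m S1 -> S0 *m q10 = q10' *m S1 ->
  umod_iso (Phi p01 q01 p10 q10) (Phi p01' q01' p10' q10').
Proof.
move=> S00 S00' S11 S11' p1 q1 p0 q0.
pose X := Phi p01 q01 p10 q10; pose X' := Phi p01' q01' p10' q10'.
have simp := (mul0mx, mulmx0, mul1mx, mulmx1, add0r, addr0).
pose F : 'M[k]_(udim X', udim X) := block_mx (block_mx S0 0 0 S1) 0 0 (block_mx S1 0 0 S1).
pose G : 'M[k]_(udim X, udim X') := block_mx (block_mx S0' 0 0 S1') 0 0 (block_mx S1' 0 0 S1').
have TS : S1 *m (1%:M + p01 *m q10) = (1%:M + p01' *m q10') *m S1.
  by rewrite mulmxDr mulmxDl mulmx1 mul1mx mulmxA p1 -!mulmxA q0.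
apply: (@iso_intro _ X X' F G).
- by split; rewrite /F /= !mulmx_block !simp ?p1 ?q1 ?p0 ?q0 ?TS.
- by rewrite /F /G !mulmx_block !simp S00 S11 -!scalar_mx_block.
- by rewrite /F /G !mulmx_block !simp S00' S11' -!scalar_mx_block.
Qed.

(* The idempotents cutting out the two vertices of the basic algebra: on ker c the
   operator ab = ba satisfies T^2 + T = a^2 b^2 and T^4 = T^2. *)
Definition w_e1 : seq (seq nat) := pmul [:: [::]; [:: 2]] [:: [:: 0; 1; 0; 1]]%N.
Definition w_e0 : seq (seq nat) := pmul [:: [::]; [:: 2]] [:: [::]; [:: 0; 1; 0; 1]]%N.

(** [Y0] and [Y1] are the images of [w_e0] and [w_e1]. Since [i0], [i1], [r0], [r1] absorb these
    idempotents, every required equation follows from an identity of words multiplied by them, which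
    [nf] decides. *)
Lemma umod_iso_Phi (X : umod k) : is_umod X ->
  exists n0 n1 (p01 q01 : 'M[k]_(n1, n0)) (p10 q10 : 'M[k]_(n0, n1)),
    graded_rel p01 q01 p10 q10 /\ umod_iso X (Phi p01 q01 p10 q10).
Proof.
move=> uX; have alg p q := pval_eq char2 uX (p := p) (q := q).
have e0e0 : pval X w_e0 *m pval X w_e0 = pval X w_e0.
  by rewrite -pval_mul; apply: alg.
have e1e1 : pval X w_e1 *m pval X w_e1 = pval X w_e1.
  by rewrite -pval_mul; apply: alg.
have [n0 [i0 [r0 [ri0 ir0]]]] := split_idempotent e0e0.
have [n1 [i1 [r1 [ri1 ir1]]]] := split_idempotent e1e1.
have i0E : i0 = pval X w_e0 *m i0 by rewrite -ir0 -mulmxA ri0 mulmx1.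
have i1E : i1 = pval X w_e1 *m i1 by rewrite -ir1 -mulmxA ri1 mulmx1.
have eq0 p q : nf (pmul p w_e0 ++ pmul q w_e0) = [::] ->
    pval X p *m i0 = pval X q *m i0.
  by move=> /alg; rewrite i0E !mulmxA -!pval_mul => ->.
have eq1 p q : nf (pmul p w_e1 ++ pmul q w_e1) = [::] ->
    pval X p *m i1 = pval X q *m i1.
  by move=> /alg; rewrite i1E !mulmxA -!pval_mul => ->.
have mid0 m n (A : 'M_(m, _)) (B : 'M_(_, n)) :
  A *m i0 *m (r0 *m B) = A *m (pval X w_e0 *m B) by rewrite -ir0 !mulmxA.
have mid1 m n (A : 'M_(m, _)) (B : 'M_(_, n)) :
  A *m i1 *m (r1 *m B) = A *m (pval X w_e1 *m B) by rewrite -ir1 !mulmxA.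
pose P := pval X [:: [:: 0; 0]]%N; pose Q := pval X [:: [:: 1; 1]]%N.
pose p01 := r1 *m (P *m i0); pose q01 := r1 *m (Q *m i0).
pose p10 := r0 *m (P *m i1); pose q10 := r0 *m (Q *m i1).
have mm p q n (B : 'M_(_, n)) : pval X p *m (pval X q *m B) = pval X (pmul p q) *m B.
  by rewrite mulmxA pval_mul.
have prod1 m (A : 'M_(m, _)) n (B : 'M_(_, n)) C :
    A *m (C *m i1) *m (r1 *m B) = A *m (C *m (pval X w_e1 *m B)).
  by rewrite [A *m _]mulmxA mid1 -!mulmxA.
have prod0 m (A : 'M_(m, _)) n (B : 'M_(_, n)) C :
    A *m (C *m i0) *m (r0 *m B) = A *m (C *m (pval X w_e0 *m B)).
  by rewrite [A *m _]mulmxA mid0 -!mulmxA.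
have rel : graded_rel p01 q01 p10 q10.
  rewrite /p01 /q01 /p10 /q10 /P /Q.
  split; [split|split| |]; rewrite ?prod1 ?prod0 !mm.
  - by rewrite (eq0 _ [::]) ?pval_nil ?mul0mx ?mulmx0.
  - by rewrite (eq1 _ [::]) ?pval_nil ?mul0mx ?mulmx0.
  - by rewrite (eq0 _ [::]) ?pval_nil ?mul0mx ?mulmx0.
  - by rewrite (eq1 _ [::]) ?pval_nil ?mul0mx ?mulmx0.
  - by congr (_ *m _); apply: eq0.
  - by congr (_ *m _); apply: eq1.
exists n0, n1, p01, q01, p10, q10; split=> //.
pose a := pval X [:: [:: 0]]%N; pose b := pval X [:: [:: 1]]%N.
have aE : ua X = a by rewrite /a pval1 /= mulmx1.
have bE : ub X = b by rewrite /b pval1 /= mulmx1.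
have cE : uc X = pval X [:: [:: 2]]%N by rewrite pval1 /= mulmx1.
have eE m (B : 'M_(_, m)) : B = pval X [:: [::]] *m B by rewrite pval1 mul1mx.
(* 1 = ab + ba on im c writes an element of im c as a y + b y' *)
pose ya := pmul ([:: 1]%N :: pmul [:: [:: 1; 1]]%N (pmul w_e0 [:: [:: 0]]%N)) [:: [:: 2]]%N.
pose yb := pmul ([:: 0]%N :: pmul [:: [:: 0; 0]]%N (pmul w_e0 [:: [:: 1]]%N)) [:: [:: 2]]%N.
pose PX := Phi p01 q01 p10 q10.
pose F : 'M[k]_(udim X, udim PX) := row_mx (row_mx i0 i1) (row_mx (a *m i1) (b *m i1)).
(* For [z] in im c the vector [b z] also has a part in [Y0]; by [a y = b (P y)] it contributes to
   the [b]-coordinate, and symmetrically for [a z]. This is the origin of the second terms of [ya]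
   and [yb]. *)
pose G : 'M[k]_(udim PX, udim X) :=
  col_mx (col_mx r0 r1) (col_mx (r1 *m pval X ya) (r1 *m pval X yb)).
have i1T : i1 *m (1%:M + p01 *m q10) =
    pval X ([::] :: pmul w_e1 (pmul [:: [:: 0; 0]] (pmul w_e0 [:: [:: 1; 1]])))%N *m i1.
  rewrite mulmxDr mulmx1 pval_cons mulmxDl mul1mx; congr (_ + _).
  by rewrite /p01 /q10 prod0 mulmxA ir1 !mm.
have i1p n (B : 'M_(_, n)) C : C *m i1 *m (r1 *m B) = C *m (pval X w_e1 *m B).
  by rewrite mid1.
have i0p n (B : 'M_(_, n)) : i0 *m (r0 *m B) = pval X w_e0 *m B.
  by rewrite mulmxA ir0.
have r0E : r0 = r0 *m pval X w_e0 by rewrite -ir0 mulmxA ri0 mul1mx.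
have r1E : r1 = r1 *m pval X w_e1 by rewrite -ir1 mulmxA ri1 mul1mx.
apply: iso_sym; apply: (@iso_intro _ PX X F G).
- split; rewrite /F /= ?aE ?bE ?cE !mul_row_block ?mul_mx_row ?(mulmx0, add0r, addr0)
    ?mul_row_block ?mul_mx_row ?(mulmx0, add0r, addr0, mulmx1) ?i1T.
  + rewrite i1p i0p /a /b !mm.
    by congr (row_mx (row_mx _ _) (row_mx _ _)); first [apply: eq0 | apply: eq1].
  + rewrite i1p i0p /a /b !mm.
    by congr (row_mx (row_mx _ _) (row_mx _ _)); first [apply: eq0 | apply: eq1].
  + rewrite -[0]row_mx0 /a /b !mm.
    rewrite [_ *m i0](eq0 _ [::]) // [pval X [:: [:: 2]]%N *m i1](eq1 _ [::]) //.
    rewrite pval_nil !mul0mx.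
    by congr (row_mx _ (row_mx _ _)); apply: eq1.
- rewrite /F /G /a /b !mul_col_row -!mulmxA !mm ri0 ri1.
  (* The blocks of [G F] have the form [r p i]; inserting the idempotents absorbed by [r] and [i]
     makes each one decidable. *)
  have zz m (r : 'M_(m, _)) e n (i : 'M_(_, n)) f p q :
      r = r *m pval X e -> i = pval X f *m i ->
      nf (pmul e (pmul p f) ++ pmul e (pmul q f)) = [::] ->
      r *m (pval X p *m i) = r *m (pval X q *m i).
    move=> -> -> /alg E; rewrite -2!(mulmxA r) (mm p f) (mm q f) (mm e) E -(mm e).
    by [].
  have zz0 m (r : 'M_(m, _)) e n (i : 'M_(_, n)) f p :
      r = r *m pval X e -> i = pval X f *m i ->
      nf (pmul e (pmul p f) ++ pmul e (pmul [::] f)) = [::] ->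
      r *m (pval X p *m i) = 0.
    by move=> rE iE E; rewrite (zz _ _ _ _ _ _ _ [::] rE iE E) pval_nil mul0mx mulmx0.
  have zz1 p : nf (pmul w_e1 (pmul p w_e1) ++ pmul w_e1 (pmul [:: [::]] w_e1)) = [::] ->
      r1 *m (pval X p *m i1) = 1%:M.
    by move=> E; rewrite (zz _ _ _ _ _ _ _ [:: [::]] r1E i1E E) -eE.
  rewrite {1}[i1]eE {1}[i0]eE !scalar_mx_block.
  have z01 p := zz0 _ _ _ _ _ _ p r0E i1E; have z10 p := zz0 _ _ _ _ _ _ p r1E i0E.
  have z11 p := zz0 _ _ _ _ _ _ p r1E i1E.
  rewrite (zz1 (pmul ya _)) // (zz1 (pmul yb [:: [:: 1]]%N)) //.
  by rewrite !z01 // !z10 // !z11 // !block_mx0.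
- rewrite /F /G !mul_row_col ir0 ir1 !i1p /a /b !mm -!pval_mul -!pval_cat.
  by rewrite (alg _ [:: [::]]) ?pval1.
Qed.

End GradedModules.

(** * Kronecker pencils *)

Section Pencils.
Variable k : fieldType.

(** A representation of the Kronecker quiver, two maps from [k^w] to [k^s], where one of the spaces
    may be zero. *)
Definition pencil_indec s w (A B : 'M[k]_(s, w)) :=
  (0 < s + w)%N /\
  forall (F : 'M_w) (G : 'M_s), F *m F = F -> G *m G = G ->
    G *m A = A *m F -> G *m B = B *m F ->
  (F = 0 /\ G = 0) \/ (F = 1%:M /\ G = 1%:M).

Definition pencil_equiv s w (A B : 'M[k]_(s, w)) s' w' (A' B' : 'M[k]_(s', w')) :=
  exists (S : 'M_(s', s)) (S' : 'M_(s, s')) (W : 'M_(w', w)) (W' : 'M_(w, w')),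
  [/\ S' *m S = 1%:M /\ S *m S' = 1%:M, W' *m W = 1%:M /\ W *m W' = 1%:M,
      S *m A = A' *m W & S *m B = B' *m W].

Lemma pencil_equiv_sym s w (A B : 'M[k]_(s, w)) s' w' (A' B' : 'M[k]_(s', w')) :
  pencil_equiv A B A' B' -> pencil_equiv A' B' A B.
Proof.
move=> [S [S' [W [W' [[SS SS'] [WW WW'] SA SB]]]]]; exists S', S, W', W; split=> //.
- by rewrite -[S' *m A']mulmx1 -WW' mulmxA -[S' *m A' *m W]mulmxA -SA mulmxA SS mul1mx.
- by rewrite -[S' *m B']mulmx1 -WW' mulmxA -[S' *m B' *m W]mulmxA -SB mulmxA SS mul1mx.
Qed.

Lemma pencil_equiv_trans s w (A B : 'M[k]_(s, w)) s' w' (A' B' : 'M[k]_(s', w'))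
    s'' w'' (A'' B'' : 'M[k]_(s'', w'')) :
  pencil_equiv A B A' B' -> pencil_equiv A' B' A'' B'' -> pencil_equiv A B A'' B''.
Proof.
move=> [S [S' [W [W' [[SS SS'] [WW WW'] SA SB]]]]].
move=> [U [U' [V [V' [[UU UU'] [VV VV'] UA UB]]]]].
exists (U *m S), (S' *m U'), (V *m W), (W' *m V'); split.
- split; first by rewrite mulmxA -[S' *m U' *m U]mulmxA UU mulmx1.
  by rewrite mulmxA -[U *m S *m S']mulmxA SS' mulmx1.
- split; first by rewrite mulmxA -[W' *m V' *m V]mulmxA VV mulmx1.
  by rewrite mulmxA -[V *m W *m W']mulmxA WW' mulmx1.
- by rewrite -mulmxA SA !mulmxA UA.
- by rewrite -mulmxA SB !mulmxA UB.
Qed.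

Lemma inverse_pair_size m n (S : 'M[k]_(m, n)) (S' : 'M_(n, m)) :
  S' *m S = 1%:M -> S *m S' = 1%:M -> m = n.
Proof.
move=> E E'; have := mxrank1 k n; have := mxrank1 k m; rewrite -E -E'.
have := mxrankM_maxl S S'; have := mxrankM_maxl S' S.
by have := rank_leq_col S; have := rank_leq_col S'; lia.
Qed.

Lemma pencil_equiv_size s w (A B : 'M[k]_(s, w)) s' w' (A' B' : 'M[k]_(s', w')) :
  pencil_equiv A B A' B' -> s' = s /\ w' = w.
Proof.
move=> [S [S' [W [W' [[SS SS'] [WW WW'] _ _]]]]].
by split; apply: inverse_pair_size; eassumption.
Qed.

Lemma pencil_equiv_indec s w (A B : 'M[k]_(s, w)) s' w' (A' B' : 'M[k]_(s', w')) :
  pencil_equiv A B A' B' -> pencil_indec A B -> pencil_indec A' B'.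
Proof.
move=> eqAB; have [es ew] := pencil_equiv_size eqAB; move: eqAB.
move=> [S [S' [W [W' [[SS SS'] [WW WW'] SA SB]]]]] [n_gt0 ind].
split=> [|F G FF GG GA GB]; first by rewrite es ew.
have tr m n (U : 'M[k]_(m, n)) U' D E : U *m U' = 1%:M ->
    U' *m D *m U *m (U' *m E *m U) = U' *m (D *m E) *m U.
  by move=> UU; rewrite -!mulmxA [U *m _]mulmxA UU mul1mx.
have back m n (U : 'M[k]_(m, n)) U' D E : U *m U' = 1%:M ->
    U' *m D *m U = E -> D = U *m E *m U'.
  by move=> UU <-; rewrite !mulmxA UU mul1mx -mulmxA UU mulmx1.
have SA' : S' *m A' = A *m W'.
  by rewrite -[A']mulmx1 -WW' [A' *m _]mulmxA -SA !mulmxA SS mul1mx.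
have SB' : S' *m B' = B *m W'.
  by rewrite -[B']mulmx1 -WW' [B' *m _]mulmxA -SB !mulmxA SS mul1mx.
case: (ind (W' *m F *m W) (S' *m G *m S)).
- by rewrite tr // FF.
- by rewrite tr // GG.
- by rewrite -[LHS]mulmxA SA -!mulmxA [G *m _]mulmxA GA !mulmxA SA'.
- by rewrite -[LHS]mulmxA SB -!mulmxA [G *m _]mulmxA GB !mulmxA SB'.
- move=> [/(back _ _ _ _ _ _ WW') -> /(back _ _ _ _ _ _ SS') ->]; left.
  by rewrite !mulmx0 !mul0mx.
- move=> [/(back _ _ _ _ _ _ WW') -> /(back _ _ _ _ _ _ SS') ->]; right.
  by rewrite !mulmx1 WW' SS'.
Qed.

Lemma row_free_complete q w (U : 'M[k]_(q, w)) : row_free U ->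
  exists m (W : 'M[k]_(w, q + m)) (V : 'M[k]_(m, w)),
    W *m col_mx U V = 1%:M /\ col_mx U V *m W = 1%:M.
Proof.
move=> freeU; pose V := row_base (U^C)%MS.
exists (\rank U^C)%MS, (pinvmx (col_mx U V)), V.
have full : row_full (col_mx U V).
  rewrite -col_leq_rank -addsmxE.
  have -> : \rank (U + V)%MS = \rank (U + U^C)%MS.
    by apply/eqmx_rank/eqmxP/adds_eqmx => //; apply: eq_row_base.
  by rewrite col_leq_rank addsmx_compl_full.
split; first by rewrite mulVpmx.
rewrite mulmxVp // /row_free (eqP full) mxrank_compl (eqP freeU) subnKC //.
by rewrite -(eqP freeU) rank_leq_col.
Qed.

Lemma rank1_identity n (c : 'cV[k]_n) (r : 'rV_n) : 1%:M = c *m r -> (n <= 1)%N.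
Proof.
move=> E; rewrite -(mxrank1 k n) E.
exact: leq_trans (mxrankM_maxl _ _) (rank_leq_col _).
Qed.

Lemma nonzero_cV_dual n (z : 'cV[k]_n) : z != 0 -> exists r : 'rV_n, r *m z = 1%:M.
Proof.
move=> z0; exists (pinvmx z); apply: mulVpmx.
by rewrite -col_leq_rank lt0n mxrank_eq0.
Qed.

Lemma nonzero_rV_dual n (z : 'rV[k]_n) : z != 0 -> exists c : 'cV_n, z *m c = 1%:M.
Proof.
move=> z0; exists (pinvmx z); apply: mulmxVp.
by rewrite -row_leq_rank lt0n mxrank_eq0.
Qed.

(** The normal forms with [w <= s <= w.+1]: for [s = w.+1] the preprojective pencil, for [s = w] a
    nilpotent Jordan block paired with the identity. *)
Definition T2A s w : 'M[k]_(s, w) := \matrix_(i, j) (i == j.+1 :> nat)%:R.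
Definition T2B s w : 'M[k]_(s, w) := \matrix_(i, j) (i == j :> nat)%:R.

Lemma pencil_refl s w (A B : 'M[k]_(s, w)) : pencil_equiv A B A B.
Proof. by exists 1%:M, 1%:M, 1%:M, 1%:M; rewrite !(mul1mx, mulmx1). Qed.

Section Block.
Variables (q r m : nat) (A2 : 'M[k]_(r, q)) (A1 B1 : 'M[k]_(r, m)).
Let A := block_mx (0 : 'M_(q, q)) 0 A2 A1.
Let B := block_mx (1%:M : 'M_q) 0 0 B1.

(** The vector [x = (z, -y)] lies in the kernel of [A], and the functional [(u, 0)] has value 1 on
    [x] and on [B x] while vanishing on the image of [A]. So [x] and [B x] span a direct summand of
    the form [(0, 1)], which must be everything. *)
Lemma block_indec_split (z : 'cV_q) y :
    pencil_indec A B -> z != 0 -> A2 *m z = A1 *m y -> (q + r <= 1 /\ q + m <= 1)%N.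
Proof.
move=> [_ ind] /nonzero_cV_dual[u uz] Az.
pose x := col_mx z (- y); pose Bx := col_mx z (- (B1 *m y)).
have Ax : A *m x = 0.
  by rewrite mul_block_col !mul0mx addr0 mulmxN Az subrr col_mx0.
have BxE : B *m x = Bx.
  by rewrite mul_block_col !mul0mx mul1mx addr0 add0r mulmxN.
case: (ind (x *m row_mx u 0) (Bx *m row_mx u 0)).
- by rewrite mulmxA -[x *m _ *m x]mulmxA mul_row_col mul0mx addr0 uz mulmx1.
- by rewrite mulmxA -[Bx *m _ *m Bx]mulmxA mul_row_col mul0mx addr0 uz mulmx1.
- by rewrite -mulmxA mul_row_block !mulmx0 !mul0mx !addr0 row_mx0 mulmx0 mulmxA Ax mul0mx.
- by rewrite -mulmxA mul_row_block !mulmx0 !mul0mx mulmx1 !addr0 mulmxA BxE.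
- move=> [/(congr1 (mulmx (row_mx u (0 : 'rV_m)))) E _].
  move: E; rewrite mulmxA mul_row_col uz mul0mx addr0 mul1mx mulmx0.
  move=> /(congr1 (mulmx^~ x)); rewrite mul_row_col uz !mul0mx addr0.
  by move=> /matrixP /(_ 0 0) /eqP; rewrite !mxE eqxx oner_eq0.
- by move=> [/esym /rank1_identity ? /esym /rank1_identity ?].
Qed.

Hypothesis char2 : (2 \in [pchar k])%N.

(** An idempotent [(F, G)] of [(A1, B1)] is extended to the whole pencil. Since [row_mx A2 A1] is
    onto, [G A2 = A2 H + A1 Z] can be solved, and [H], [Z] fill the missing blocks. Injectivity of
    [A2] modulo the image of [A1] makes [H] idempotent. *)
Lemma block_indec_sub : pencil_indec A B -> row_free (row_mx A2 A1) ->
    (forall (z : 'cV_q) y, A2 *m z = A1 *m y -> z = 0) -> (0 < r + m)%N ->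
  pencil_indec A1 B1.
Proof.
move=> [_ ind] free inj n_gt0; split=> // F G FF GG GA GB.
have injM n (Z : 'M_(q, n)) Y : A2 *m Z = A1 *m Y -> Z = 0.
  move=> E; apply/matrixP=> i j; have : col j Z = 0.
    by apply: (inj _ (col j Y)); rewrite !colE !mulmxA E.
  by move=> /matrixP /(_ i 0); rewrite !mxE.
pose R := pinvmx (row_mx A2 A1) *m (G *m A2).
have : row_mx A2 A1 *m R = G *m A2 by rewrite /R mulmxA mulmxVp // mul1mx.
rewrite -[R]vsubmxK mul_row_col; move: (usubmx R) (dsubmx R) => H Z GA2.
(* Multiplying [G A2 = A2 H + A1 Z] by [G] gives [A2 (H^2 - H) = A1 (Z - F Z - Z H)]. *)
have HH : H *m H = H.
  apply/eqP; rewrite -subr_eq0; apply/eqP; apply: (injM _ _ (Z - F *m Z - Z *m H)).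
  have := congr1 (mulmx G) GA2; rewrite mulmxDr !mulmxA GG GA -GA2 mulmxDl.
  rewrite !mulmxBr !mulmxA; move: (A2 *m H *m H) (A1 *m Z *m H) (A1 *m F *m Z) => X U W.
  move: (A2 *m H) (A1 *m Z) => Y V E.
  have -> : X = Y + V - W - U by rewrite -E addrK addrK.
  by apply/matrixP=> i j; rewrite !mxE; ring.
pose F' : 'M_(q + m) := block_mx H 0 Z F.
pose G' : 'M_(q + r) := block_mx H 0 (B1 *m Z) G.
have simp := (mul0mx, mulmx0, mul1mx, mulmx1, add0r, addr0).
have GA' : G' *m A = A *m F' by rewrite /G' /F' !mulmx_block !simp GA2 GA.
have GB' : G' *m B = B *m F' by rewrite /G' /F' !mulmx_block !simp GB.
(* In characteristic 2 the square of an idempotent modulo a square-zero ideal is idempotent. *)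
have sq n n' (K : 'M_n) (L : 'M_n') (Y : 'M[k]_(n', n)) : K *m K = K -> L *m L = L ->
    let M := block_mx K 0 Y L *m block_mx K 0 Y L in M *m M = M.
  move=> KK LL /=; rewrite !mulmx_block !simp !KK !LL.
  congr block_mx; rewrite mulmxDl mulmxDr -!mulmxA KK !mulmxA LL.
  rewrite addrCA !addrA; congr (_ + _).
  by rewrite addrAC (addmx_char2 char2) add0r.
case: (ind (F' *m F') (G' *m G')).
- exact: sq.
- exact: sq.
- by rewrite -mulmxA GA' !mulmxA GA'.
- by rewrite -mulmxA GB' !mulmxA GB'.
- rewrite /F' /G' !mulmx_block !simp FF GG -[X in _ = X /\ _]submxK -[X in _ /\ _ = X]submxK.
  case=> /eq_block_mx[_ _ _ ->] /eq_block_mx[_ _ _ ->]; left.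
  by split; apply/matrixP=> i j; rewrite !mxE.
- rewrite /F' /G' !mulmx_block !simp FF GG !scalar_mx_block.
  by case=> /eq_block_mx[_ _ _ ->] /eq_block_mx[_ _ _ ->]; right.
Qed.

End Block.

(** The rows of [U] span the functionals vanishing on the image of [A]. One that also vanishes on
    the image of [B] splits off the pencil with [s = 1], [w = 0]. If there is none, [U] and [U B]
    are completed to bases. The block [B2] left below the identity is then cleared by adding
    multiples of rows of [U], which does not change [A] because [U A = 0]. *)
Lemma pencil_normal_form s w (A B : 'M[k]_(s, w)) :
    pencil_indec A B -> (\rank A < s)%N ->
  (s = 1 /\ w = 0)%N \/
  exists q r m (A2 : 'M_(r, q)) (A1 B1 : 'M_(r, m)),
    [/\ (0 < q)%N, s = (q + r)%N, row_free (row_mx A2 A1) &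
        pencil_equiv A B (block_mx (0 : 'M_(q, q)) 0 A2 A1) (block_mx 1%:M 0 0 B1)].
Proof.
move=> [n_gt0 ind] rkA; pose U := row_base (kermx A).
have freeU : row_free U by apply: row_base_free.
have UA : U *m A = 0.
  by apply/eqP; rewrite -sub_kermx /U eq_row_base.
have q_gt0 : (0 < \rank (kermx A))%N by rewrite mxrank_ker subn_gt0.
have kerU (x : 'rV_s) : x *m A = 0 -> (x <= U)%MS.
  by move=> xA; rewrite /U eq_row_base; apply/sub_kermxP.
move: (\rank _) q_gt0 U freeU UA kerU => q q_gt0 U freeU UA kerU.
case: (boolP (row_free (U *m B))) => [freeUB|]; last first.
  rewrite -kermx_eq0 => /rowV0Pn[x]; rewrite sub_kermx => /eqP xUB x0; left.
  have u0 : x *m U != 0.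
    apply: contra_neq x0 => xU; apply: (row_free_inj freeU).
    by rewrite xU mul0mx.
  have [v uv] := nonzero_rV_dual u0.
  case: (ind 0 (v *m (x *m U))).
  - by rewrite mulmx0.
  - by rewrite mulmxA -[v *m _ *m v]mulmxA uv mulmx1.
  - by rewrite -!mulmxA UA !mulmx0.
  - by rewrite -!mulmxA xUB !mulmx0.
  - move=> [_ vu]; have /matrixP /(_ 0 0) := congr1 (fun M => x *m U *m M *m v) vu.
    rewrite mulmxA uv mul1mx uv mulmx0 mul0mx => /eqP.
    by rewrite !mxE eqxx oner_eq0.
  - move=> [F0 /esym /rank1_identity s1]; split; first by lia.
    by apply/eqP; move/esym/(congr1 mxrank): F0; rewrite mxrank1 mxrank0 => ->.
right.
have [r [S' [V [SS SS']]]] := row_free_complete freeU.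
have [m [W [T [WW WW']]]] := row_free_complete freeUB.
pose A2 := lsubmx (V *m A *m W); pose A1 := rsubmx (V *m A *m W).
pose B2 := lsubmx (V *m B *m W); pose B1 := rsubmx (V *m B *m W).
have AE : row_mx A2 A1 = V *m A *m W by rewrite hsubmxK.
have BE : row_mx B2 B1 = V *m B *m W by rewrite hsubmxK.
have simp := (mul0mx, mulmx0, mul1mx, mulmx1, add0r, addr0).
exists q, r, m, A2, A1, B1; split=> //.
- exact: esym (inverse_pair_size SS SS').
(* A row [x] killing [row_mx A2 A1] makes [x V] a functional vanishing on the image of [A], so it
   lies in the span of [U]; but the rows of [U] and [V] are independent. *)
- rewrite -kermx_eq0; apply/rowV0P => x; rewrite sub_kermx AE => /eqP xAW.
  have xA : x *m V *m A = 0.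
    rewrite -[LHS]mulmx1 -WW !mulmxA -[x *m V *m A]mulmxA -[x *m (V *m A) *m W]mulmxA.
    by rewrite xAW mul0mx.
  have /submxP[y xE] := kerU _ xA.
  have : row_mx (- y) x *m col_mx U V = 0.
    by rewrite mul_row_col xE mulNmx addNr.
  move/(congr1 (mulmx^~ S')); rewrite -mulmxA SS' mulmx1 mul0mx -row_mx0.
  by case/eq_row_mx.
- have inv n n' (Y : 'M[k]_(n', n)) : block_mx 1%:M 0 Y 1%:M *m block_mx 1%:M 0 (- Y) 1%:M = 1%:M.
    by rewrite mulmx_block !simp addrN -scalar_mx_block.
  exists (block_mx 1%:M 0 (- B2) 1%:M *m col_mx U V), (S' *m block_mx 1%:M 0 B2 1%:M).
  exists (col_mx (U *m B) T), W; split=> //.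
  + split; first by rewrite mulmxA -[S' *m _ *m _]mulmxA inv mulmx1.
    rewrite mulmxA -[_ *m S']mulmxA SS' mulmx1 -{2}[B2]opprK; exact: inv.
  + rewrite -mulmxA (mul_col_mx U V) UA !mul_block_col !simp; congr col_mx.
    by rewrite -mul_row_col AE -mulmxA WW mulmx1.
  + rewrite -mulmxA (mul_col_mx U V) !mul_block_col !simp; congr col_mx.
    by rewrite -[V *m B]mulmx1 -WW [_ *m (W *m _)]mulmxA -BE mul_row_col mulNmx addKr.
Qed.

Lemma T2B_square n : T2B n n = 1%:M.
Proof. by apply/matrixP=> i j; rewrite !mxE. Qed.

(** The solutions of [A2 z = A1 y] form the kernel of one matrix; either some row of the kernel
    matrix has a nonzero [z]-part or all of these parts vanish. *)
Lemma common_image_dec q r m (A2 : 'M[k]_(r, q)) (A1 : 'M[k]_(r, m)) :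
  (exists2 z : 'cV_q, z != 0 & exists y, A2 *m z = A1 *m y) \/
  (forall (z : 'cV_q) y, A2 *m z = A1 *m y -> z = 0).
Proof.
pose K := kermx (row_mx A2 A1)^T.
have [/existsP[i Ki]|/existsPn K0] := boolP [exists i, lsubmx (row i K) != 0].
  left; exists (lsubmx (row i K))^T; first by rewrite trmx_eq0.
  exists (- (rsubmx (row i K))^T); apply/eqP; rewrite mulmxN -addr_eq0; apply/eqP.
  rewrite -mul_row_col -tr_row_mx hsubmxK -[row_mx _ _]trmxK -trmx_mul -row_mul.
  by rewrite mulmx_ker row0 trmx0.
right=> z y E.
have lK : lsubmx K = 0.
  apply/row_matrixP=> i; have := K0 i; rewrite negbK row0 => /eqP <-.
  by apply/rowP=> j; rewrite !mxE.
have : row_mx z^T (- y)^T *m (row_mx A2 A1)^T = 0.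
  by rewrite -tr_col_mx -trmx_mul mul_row_col mulmxN E subrr trmx0.
move/sub_kermxP/submxP=> [u]; rewrite -/K -[K]hsubmxK mul_mx_row lK mulmx0.
by case/eq_row_mx=> /(congr1 trmx); rewrite trmxK trmx0.
Qed.

Lemma T2A_block r m : T2A (1 + r.+1) (1 + m) =
  block_mx (0 : 'M_(1, 1)) 0 (delta_mx 0 0) (T2A r.+1 m).
Proof.
apply/matrixP=> i j; case: (split_ordP i) => i' ->; case: (split_ordP j) => j' ->.
- by rewrite block_mxEul !mxE /= ord1.
- by rewrite block_mxEur !mxE /= ord1.
- by rewrite block_mxEdl !mxE /= !ord1 eqxx andbT add1n eqSS.
- by rewrite block_mxEdr !mxE.
Qed.

Lemma T2B_block r m : T2B (1 + r) (1 + m) = block_mx (1%:M : 'M_1) 0 0 (T2B r m).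
Proof.
apply/matrixP=> i j; case: (split_ordP i) => i' ->; case: (split_ordP j) => j' ->.
- by rewrite block_mxEul !mxE /= !ord1.
- by rewrite block_mxEur !mxE /= !ord1.
- by rewrite block_mxEdl !mxE /= !ord1.
- by rewrite block_mxEdr !mxE.
Qed.

(* Induction on s.  Splitting off the cokernel of A writes the pencil as
   ([0 0; A2 A1], [1 0; 0 B1]).  If A2 meets the image of A1, a summand (0, 1) splits off;
   otherwise (A1, B1) is again indecomposable and the one missing row of A1 is hit by A2. *)
Lemma pencil_not_onto s w (A B : 'M[k]_(s, w)) : (2 \in [pchar k])%N ->
    pencil_indec A B -> (\rank A < s)%N ->
  (w <= s <= w.+1)%N /\ pencil_equiv A B (T2A s w) (T2B s w).
Proof.
move=> char2; have [n] := ubnP s; elim: n s w A B => // n IH s w A B s_lt indAB rkA.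
case: (pencil_normal_form indAB rkA) => [[s1 w0]|].
  subst s w; split=> //; exists 1%:M, 1%:M, 1%:M, 1%:M.
  by rewrite !(mul1mx, mulmx1) [A]thinmx0 [B]thinmx0 [T2A _ _]thinmx0 [T2B _ _]thinmx0.
move=> [q [r [m [A2 [A1 [B1 [q_gt0 sE free eqAB]]]]]]].
have [_ wE] := pencil_equiv_size eqAB; subst s w.
have indB := pencil_equiv_indec eqAB indAB.
suff [le_wsw eqT] : (q + m <= q + r <= (q + m).+1)%N /\
    pencil_equiv (block_mx (0 : 'M_(q, q)) 0 A2 A1) (block_mx 1%:M 0 0 B1)
      (T2A (q + r) (q + m)) (T2B (q + r) (q + m)).
  by split=> //; apply: pencil_equiv_trans eqAB eqT.
case: (common_image_dec A2 A1) => [[z z0 [y zy]]|inj].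
  have [qr qm] := block_indec_split indB z0 zy.
  have [q1 r0 m0] : [/\ q = 1, r = 0 & m = 0]%N by split; lia.
  subst q r m; split=> //; rewrite T2B_square [A2]flatmx0 [A1]flatmx0 block_mx0.
  have -> : B1 = 1%:M by rewrite [LHS]flatmx0 [RHS]flatmx0.
  rewrite -scalar_mx_block.
  have -> : T2A (1 + 0) (1 + 0) = 0.
    by apply/matrixP=> i j; rewrite !mxE; have := ltn_ord i; case: eqP => //; lia.
  exact: pencil_refl.
(* The all-ones vector stands for an arbitrary nonzero vector of [k^q]. That [A2] sends it outside
   the image of [A1] gives both [0 < r] and that [A1] is not onto. *)
have contra (y : 'cV_m) : A2 *m const_mx 1 <> A1 *m y.
  move=> E; have /matrixP /(_ (Ordinal q_gt0) 0) := inj _ _ E.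
  by move/eqP; rewrite !mxE oner_eq0.
have r_gt0 : (0 < r)%N.
  rewrite lt0n; apply/eqP => r0; subst r; apply: (contra 0).
  by rewrite [LHS]flatmx0 [RHS]flatmx0.
have rkA1 : (\rank A1 < r)%N.
  rewrite ltn_neqAle rank_leq_row andbT; apply/negP => freeA1.
  apply: (contra (pinvmx A1 *m (A2 *m const_mx 1))).
  by rewrite mulmxA mulmxVp // mul1mx.
have indA1 : pencil_indec A1 B1.
  by apply: block_indec_sub indB free inj _; rewrite // addn_gt0 r_gt0.
have [le_mr [S [S' [W [W' [[SS SS'] [WW WW'] SA SB]]]]]] : (m <= r <= m.+1)%N /\
  pencil_equiv A1 B1 (T2A r m) (T2B r m) by apply: IH => //; lia.
pose A2' := S *m A2.
have inj' (z : 'cV_q) y : A2' *m z = T2A r m *m y -> z = 0.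
  move=> E; apply: (inj z (W' *m y)).
  rewrite -[LHS]mul1mx -SS -mulmxA [S *m _]mulmxA -/A2' E.
  rewrite -[y in LHS]mul1mx -WW' -[W *m W' *m y]mulmxA [T2A r m *m _]mulmxA.
  by rewrite -SA !mulmxA SS mul1mx.
suff [le_wsw eqT] : (q + m <= q + r <= (q + m).+1)%N /\
    pencil_equiv (block_mx (0 : 'M_(q, q)) 0 A2' (T2A r m)) (block_mx 1%:M 0 0 (T2B r m))
      (T2A (q + r) (q + m)) (T2B (q + r) (q + m)).
  split=> //; apply: pencil_equiv_trans eqT.
  exists (block_mx 1%:M 0 0 S), (block_mx 1%:M 0 0 S').
  exists (block_mx 1%:M 0 0 W), (block_mx 1%:M 0 0 W').
  have simp := (mul0mx, mulmx0, mul1mx, mulmx1, add0r, addr0).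
  rewrite !mulmx_block !simp SS SS' WW WW' -!scalar_mx_block SA SB.
  by split.
move: A2' inj' => X injX; clear - injX q_gt0 r_gt0 le_mr.
case: r r_gt0 le_mr X injX => // r _ le_mr X injX.
(* As [r <= m], the image of [T2A r.+1 m] is spanned by all basis vectors except the first, so [X]
   can be reduced to its first row. If [m = r.+1], the last row of [x0] is a default value of
   [inord]; it meets the zero column of [T2A]. *)
have [x0 XE] : exists x0, X = \matrix_(i, j) (X 0 j *+ (i == 0)) + T2A r.+1 m *m x0.
  exists (\matrix_(i < m, j < q) X (inord i.+1) j); apply/matrixP=> i j.
  rewrite !mxE; case: (unliftP 0 i) => [i'|] -> /=.
    rewrite mulr0n add0r.
    have lt_i'm : (i' < m)%N by have := ltn_ord i'; lia.
    rewrite (bigD1 (Ordinal lt_i'm)) //= big1 => [|l ne].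
      rewrite !mxE eqxx mul1r addr0; congr (X _ _); apply: val_inj.
      by rewrite /= inordK // ltnS ltn_ord.
    rewrite !mxE lift0; case: eqP => [[E]|]; last by rewrite mul0r.
    by case/eqP: ne; apply: val_inj; rewrite /= E.
  rewrite big1 ?addr0 // => l _; by rewrite !mxE mul0r.
have {}XE : X = delta_mx 0 0 *m row 0 X + T2A r.+1 m *m x0.
  rewrite {1}XE; congr (_ + _); apply/matrixP=> i j.
  by rewrite !mxE big_ord1 !mxE eqxx andbT mulr_natl.
(* Modulo that image [X] is the single functional [row 0 X], which has to be injective on [k^q]. *)
have q1 : q = 1%N.
  apply/eqP; rewrite eqn_leq q_gt0 andbT.
  have : row_free (row 0 X)^T.
    rewrite -kermx_eq0; apply/rowV0P => z; rewrite sub_kermx => /eqP az.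
    apply: (can_inj (@trmxK _ _ _)); rewrite trmx0; apply: (injX _ (x0 *m z^T)).
    rewrite XE mulmxDl -mulmxA -[row 0 X]trmxK -trmx_mul az.
    by rewrite trmx0 mulmx0 add0r mulmxA.
  by move/eqP=> <-; apply: rank_leq_col.
subst q; move: XE; rewrite [row 0 X]mx11_scalar; move: (row 0 X 0 0) => a XE.
have a0 : a != 0.
  apply/eqP => a_0; move: XE; rewrite a_0 raddf0 mulmx0 add0r => XE.
  have := injX 1%:M x0; rewrite mulmx1 => /(_ XE) /matrixP /(_ 0 0) /eqP.
  by rewrite !mxE oner_eq0.
split; first by lia.
have simp := (mul0mx, mulmx0, mul1mx, mulmx1, add0r, addr0).
have inv n (Y : 'M[k]_(n, 1)) : block_mx a%:M 0 Y 1%:M *m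
    block_mx a^-1%:M 0 (- (Y *m a^-1%:M)) 1%:M = 1%:M.
  by rewrite mulmx_block !simp -scalar_mxM divff // subrr -scalar_mx_block.
have inv' n (Y : 'M[k]_(n, 1)) : block_mx a^-1%:M 0 (- (Y *m a^-1%:M)) 1%:M *m
    block_mx a%:M 0 Y 1%:M = 1%:M.
  by rewrite mulmx_block !simp mulNmx -mulmxA -!scalar_mxM mulVf // mulmx1 addNr -scalar_mx_block.
rewrite T2A_block T2B_block.
(* The column operation absorbs [T2A x0] and the scalar [a]; the row operation undoes its effect on
   the second matrix. *)
exists (block_mx a%:M 0 (T2B r.+1 m *m x0) 1%:M).
exists (block_mx a^-1%:M 0 (- (T2B r.+1 m *m x0 *m a^-1%:M)) 1%:M).
exists (block_mx a%:M 0 x0 1%:M), (block_mx a^-1%:M 0 (- (x0 *m a^-1%:M)) 1%:M).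
by split; rewrite ?inv ?inv' // !mulmx_block !simp -?XE.
Qed.

End Pencils.

(** * Transposition and reversal of pencils *)

Section Reversal.
Variable k : fieldType.

(** Conjugation by the order-reversing permutations. It exchanges the two off-diagonals and so turns
    lower Jordan blocks and transposed [T2] pencils into the shape [T1]. *)
Lemma pencil_equiv_rev s w (A B : 'M[k]_(s, w)) :
  pencil_equiv A B (\matrix_(i, j) A (rev_ord i) (rev_ord j))
                   (\matrix_(i, j) B (rev_ord i) (rev_ord j)).
Proof.
pose R n : 'M[k]_n := \matrix_(i, j) (j == rev_ord i)%:R.
have RM m n (M : 'M_(m, n)) : R m *m M = \matrix_(i, j) M (rev_ord i) j.
  apply/matrixP=> i j; rewrite !mxE (bigD1 (rev_ord i)) //= big1 => [|l ne].
    by rewrite mxE eqxx mul1r addr0.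
  by rewrite mxE (negbTE ne) mul0r.
have MR m n (M : 'M_(m, n)) : M *m R n = \matrix_(i, j) M i (rev_ord j).
  apply/matrixP=> i j; rewrite !mxE (bigD1 (rev_ord j)) //= big1 => [|l ne].
    by rewrite mxE rev_ordK eqxx mulr1 addr0.
  by rewrite mxE -(inj_eq rev_ord_inj) rev_ordK eq_sym (negbTE ne) mulr0.
have RR n : R n *m R n = 1%:M.
  by rewrite RM; apply/matrixP=> i j; rewrite !mxE rev_ordK eq_sym.
exists (R s), (R s), (R w), (R w); split; rewrite ?RR // !RM !MR.
  by apply/matrixP=> i j; rewrite !mxE rev_ordK.
by apply/matrixP=> i j; rewrite !mxE rev_ordK.
Qed.

Lemma pencil_equiv_tr s w (A B : 'M[k]_(s, w)) s' w' (A' B' : 'M[k]_(s', w')) :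
  pencil_equiv A B A' B' -> pencil_equiv A^T B^T A'^T B'^T.
Proof.
move/pencil_equiv_sym=> [S [S' [W [W' [[SS SS'] [WW WW'] SA SB]]]]].
exists W^T, W'^T, S^T, S'^T; rewrite -!trmx_mul SS SS' WW WW' SA SB !trmx1.
by split.
Qed.

Lemma pencil_indec_tr s w (A B : 'M[k]_(s, w)) :
  pencil_indec A B -> pencil_indec A^T B^T.
Proof.
move=> [n_gt0 ind]; split=> [|F G FF GG GA GB]; first by rewrite addnC.
case: (ind G^T F^T).
- by rewrite -trmx_mul GG.
- by rewrite -trmx_mul FF.
- by apply: (can_inj (@trmxK _ _ _)); rewrite !trmx_mul !trmxK GA.
- by apply: (can_inj (@trmxK _ _ _)); rewrite !trmx_mul !trmxK GB.
- by move=> [G0 F0]; left; split; apply: (can_inj (@trmxK _ _ _)); rewrite ?G0 ?F0 trmx0.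
- by move=> [G0 F0]; right; split; apply: (can_inj (@trmxK _ _ _)); rewrite ?G0 ?F0 trmx1.
Qed.

(** The normal forms with [s <= w <= s.+1]: for [s = w] the identity with a Jordan block of
    eigenvalue [lam], for [w = s.+1] and [lam = 0] the preinjective pencil. *)
Definition T1A s w : 'M[k]_(s, w) := \matrix_(i, j) (i == j :> nat)%:R.
Definition T1B lam s w : 'M[k]_(s, w) :=
  \matrix_(i, j) ((i.+1 == j :> nat)%:R + lam *+ (i == j :> nat)).

End Reversal.

(** * Pencils over an algebraically closed field *)

Section Closed.
Variable k : closedFieldType.
Hypothesis char2 : (2 \in [pchar k])%N.

Lemma closed_eigenvalue n (C : 'M[k]_n) : (0 < n)%N -> exists lam, eigenvalue C lam.
Proof.
move=> n_gt0; have /closed_rootP[lam] : size (char_poly C) != 1%N.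
  by rewrite size_char_poly; case: n n_gt0 C.
by exists lam; rewrite eigenvalue_root_char.
Qed.

Lemma pencil_class s w (A B : 'M[k]_(s, w)) : pencil_indec A B ->
  ((w <= s <= w.+1)%N /\ pencil_equiv A B (T2A k s w) (T2B k s w)) \/
  (exists lam, [/\ (s <= w <= s.+1)%N, (s < w)%N -> lam = 0 &
     pencil_equiv A B (T1A k s w) (T1B lam s w)]).
Proof.
move=> indAB; have [|le_s_rk] := ltnP (\rank A) s.
  by move=> /(pencil_not_onto char2 indAB); left.
right; have [|le_w_rk] := ltnP (\rank A) w.
  rewrite -mxrank_tr => lt_rk.
  have [le_sw /pencil_equiv_tr] := pencil_not_onto char2 (pencil_indec_tr indAB) lt_rk.
  rewrite !trmxK => eqAB; rewrite mxrank_tr in lt_rk.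
  have wE : w = s.+1 by move: lt_rk; lia.
  subst w; exists 0; split=> //; apply: pencil_equiv_trans eqAB _.
  set T1 := T1A _ _ _; set T2 := T1B _ _ _.
  have -> : T1 = \matrix_(i, j) (T2A k s.+1 s)^T (rev_ord i) (rev_ord j).
    apply/matrixP=> i j; rewrite !mxE /=; congr (_%:R); congr nat_of_bool.
    by have lti := ltn_ord i; have ltj := ltn_ord j; apply/idP/idP; lia.
  have -> : T2 = \matrix_(i, j) (T2B k s.+1 s)^T (rev_ord i) (rev_ord j).
    apply/matrixP=> i j; rewrite !mxE mul0rn addr0; congr (_%:R); congr nat_of_bool.
    by have lti := ltn_ord i; have ltj := ltn_ord j; rewrite /=; apply/idP/idP; lia.
  exact: pencil_equiv_rev.
have ws : w = s.
  by have := rank_leq_row A; have := rank_leq_col A; lia.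
subst w.
have unitA : A \in unitmx by rewrite -row_full_unit -col_leq_rank.
pose C := invmx A *m B.
have eqC : pencil_equiv A B 1%:M C.
  exists (invmx A), A, 1%:M, 1%:M; split; rewrite ?mulmx1 ?mulmxV ?mulVmx //.
have indC := pencil_equiv_indec eqC indAB.
have s_gt0 : (0 < s)%N by case: indAB => + _; lia.
have [lam lamE] := closed_eigenvalue C s_gt0.
(* The endomorphisms of [(1, C)] are the matrices commuting with [C], and these are also the
   endomorphisms of [(C - lam, 1)], whose first map is singular. *)
have indN : pencil_indec (C - lam%:M) 1%:M.
  case: indC => n_gt0 ind; split=> // F G FF GG GC; rewrite mulmx1 mul1mx => GF.
  apply: ind => //; subst G; first by rewrite mulmx1 mul1mx.
  by move: GC; rewrite mulmxBr mulmxBl scalar_mxC => /addIr.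
have rkN : (\rank (C - lam%:M)%R < s)%N.
  by move: lamE; rewrite /eigenvalue /eigenspace kermx_eq0 -row_leq_rank -ltnNge.
have [_ [S [S' [W [W' [[SS SS'] _ SN]]]]]] := pencil_not_onto char2 indN rkN.
(* The second map is the identity in both pencils, so the two base changes agree and [C] is
   conjugated to a Jordan block. *)
rewrite T2B_square mulmx1 mul1mx => WS; subst W.
exists lam; split; rewrite ?leqnn ?leqnSn ?ltnn //.
apply: pencil_equiv_trans eqC _.
apply: (@pencil_equiv_trans _ _ _ _ _ _ _ 1%:M (T2A k s s + lam%:M)).
  exists S, S', S, S'; split; rewrite ?mulmx1 ?mul1mx //.
  by rewrite mulmxDl -SN mulmxBr scalar_mxC subrK.
have -> : T1A k s s = \matrix_(i, j) (1%:M : 'M_s) (rev_ord i) (rev_ord j).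
  by apply/matrixP=> i j; rewrite !mxE (inj_eq rev_ord_inj).
have -> : T1B lam s s = \matrix_(i, j) (T2A k s s + lam%:M) (rev_ord i) (rev_ord j).
  apply/matrixP=> i j; rewrite !mxE (inj_eq rev_ord_inj); congr (_%:R + _).
  by congr nat_of_bool; have lti := ltn_ord i; have ltj := ltn_ord j; rewrite /=; apply/idP/idP; lia.
exact: pencil_equiv_rev.
Qed.

End Closed.

(** * Indecomposable graded modules *)

Section GradedClass.
Variable k : fieldType.

(* The free graded k[P,Q]/(P^2,Q^2)-module of rank one, in the bases (1, PQ) and (P, Q). *)
Definition free_p01 : 'M[k]_(1 + 1) := block_mx 1%:M 0 0 0.
Definition free_q01 : 'M[k]_(1 + 1) := block_mx 0 0 1%:M 0.
Definition free_p10 : 'M[k]_(1 + 1) := block_mx 0 0 0 1%:M.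
Definition free_q10 : 'M[k]_(1 + 1) := block_mx 0 0 1%:M 0.

Let simp := (mul0mx, mulmx0, mul1mx, mulmx1, add0r, addr0).

(** Choose a functional [g] and a vector [y] with [g (PQ y) = 1]. Then [y], [PQ y], [P y], [Q y]
    span a free submodule. It splits off because the algebra is Frobenius: the coordinates on it are
    the values of [g] after applying [PQ], 1, [Q] and [P]. Indecomposability makes it everything. *)
Lemma graded_free_split n0 n1 (p01 q01 : 'M[k]_(n1, n0)) (p10 q10 : 'M[k]_(n0, n1)) :
    graded_rel p01 q01 p10 q10 -> graded_indec p01 q01 p10 q10 -> q10 *m p01 != 0 ->
  exists (S0 : 'M_(1 + 1, n0)) S0' (S1 : 'M_(1 + 1, n1)) S1',
   [/\ (S0' *m S0 = 1%:M /\ S0 *m S0' = 1%:M), (S1' *m S1 = 1%:M /\ S1 *m S1' = 1%:M),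
       S1 *m p01 = free_p01 *m S0 /\ S1 *m q01 = free_q01 *m S0 &
       S0 *m p10 = free_p10 *m S1 /\ S0 *m q10 = free_q10 *m S1].
Proof.
move=> [[pp pp'] [qq qq'] qp pq] [_ ind] /matrix0Pn[i [j Mij]].
pose M := q10 *m p01.
have MM : M *m M = 0 by rewrite /M {1}qp mulmxA -[p10 *m q01 *m q10]mulmxA qq' mulmx0 mul0mx.
pose g : 'rV[k]_n0 := delta_mx 0 i.
pose y0 : 'cV[k]_n0 := (M i j)^-1 *: delta_mx j 0.
have gMy0 : g *m M *m y0 = 1%:M.
  rewrite -rowE -scalemxAr -colE; apply/matrixP=> a b.
  by rewrite !ord1 [LHS]mxE [col _ _ _ _]mxE [row _ _ _ _]mxE mulVf // mxE.
(* This correction achieves [g y = 0] and keeps [g M y = 1], since [M^2 = 0]; the coordinates are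
   then exactly dual to the basis. *)
pose y := y0 - M *m y0 *m (g *m y0).
have gy : g *m y = 0.
  by rewrite mulmxBr [g *m (_ *m (g *m y0))]mulmxA [g *m (_ *m _)]mulmxA gMy0 mul1mx subrr.
have gMy : g *m M *m y = 1%:M.
  rewrite mulmxBr gMy0 [g *m M *m (_ *m (g *m y0))]mulmxA [g *m M *m (M *m _)]mulmxA.
  by rewrite -[g *m M *m M]mulmxA MM mulmx0 !mul0mx subr0.
have Mp0 : M *m p10 = 0 by rewrite -mulmxA pp' mulmx0.
have Mq0 : M *m q10 = 0 by rewrite /M qp -mulmxA qq' mulmx0.
have pM0 : p01 *m M = 0 by rewrite /M qp mulmxA pp' mul0mx.
have qM0 : q01 *m M = 0 by rewrite mulmxA qq' mul0mx.
have qpM : q10 *m p01 = M by [].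
have pqM : p10 *m q01 = M by rewrite -qp.
clearbody y g M; clear y0 gMy0 Mij.
pose T0 : 'M_(n0, 1 + 1) := row_mx y (M *m y).
pose T1 : 'M_(n1, 1 + 1) := row_mx (p01 *m y) (q01 *m y).
pose S0 : 'M_(1 + 1, n0) := col_mx (g *m M) g.
pose S1 : 'M_(1 + 1, n1) := col_mx (g *m q10) (g *m p10).
have assoc m (u : 'rV[k]_n0) (A : 'M_(n0, m)) B (v : 'cV_n0) C : A *m B = C ->
    u *m A *m (B *m v) = u *m C *m v by move=> <-; rewrite !mulmxA.
have ST0 : S0 *m T0 = 1%:M.
  rewrite mul_col_row gMy gy (mulmxA g M y) gMy (assoc _ _ _ _ _ _ MM).
  by rewrite mulmx0 mul0mx -scalar_mx_block.
have ST1 : S1 *m T1 = 1%:M.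
  rewrite mul_col_row (assoc _ _ _ _ _ _ qpM) (assoc _ _ _ _ _ _ pqM) gMy.
  by rewrite (assoc _ _ _ _ _ _ pp) (assoc _ _ _ _ _ _ qq) mulmx0 mul0mx -scalar_mx_block.
have Sp01 : S1 *m p01 = free_p01 *m S0.
  by rewrite mul_col_mx mul_block_col !simp -!mulmxA qpM pp mulmx0.
have Sq01 : S1 *m q01 = free_q01 *m S0.
  by rewrite mul_col_mx mul_block_col !simp -!mulmxA pqM qq mulmx0.
have Sp10 : S0 *m p10 = free_p10 *m S1.
  by rewrite mul_col_mx mul_block_col !simp -!mulmxA Mp0 mulmx0.
have Sq10 : S0 *m q10 = free_q10 *m S1.
  by rewrite mul_col_mx mul_block_col !simp -!mulmxA Mq0 mulmx0.
have Tp01 : p01 *m T0 = T1 *m free_p01.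
  by rewrite mul_mx_row mul_row_block !simp mulmxA pM0 mul0mx.
have Tq01 : q01 *m T0 = T1 *m free_q01.
  by rewrite mul_mx_row mul_row_block !simp mulmxA qM0 mul0mx.
have Tp10 : p10 *m T1 = T0 *m free_p10.
  by rewrite mul_mx_row mul_row_block !simp !mulmxA pqM pp mul0mx.
have Tq10 : q10 *m T1 = T0 *m free_q10.
  by rewrite mul_mx_row mul_row_block !simp !mulmxA qpM qq mul0mx.
have com n n' (S : 'M[k]_(1 + 1, n)) (T : 'M_(n, 1 + 1)) (S' : 'M[k]_(1 + 1, n')) T' p' p :
    S *m p = p' *m S' -> p *m T' = T *m p' -> T *m S *m p = p *m (T' *m S').
  by move=> Sp Tp; rewrite -mulmxA Sp !mulmxA Tp.
have idem n (S : 'M[k]_(1 + 1, n)) T : S *m T = 1%:M -> T *m S *m (T *m S) = T *m S.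
  by move=> ST; rewrite mulmxA -[T *m S *m T]mulmxA ST mulmx1.
exists S0, T0, S1, T1; case: (ind (T0 *m S0) (T1 *m S1)).
- exact: idem.
- exact: idem.
- exact: com Sp01 Tp01.
- exact: com Sq01 Tq01.
- exact: com Sp10 Tp10.
- exact: com Sq10 Tq10.
- move=> [/(congr1 (mulmx S0)) E _]; rewrite mulmxA ST0 mul1mx mulmx0 in E.
  move: ST0; rewrite E mul0mx => /matrixP/(_ 0 0)/eqP.
  by rewrite !mxE eq_sym oner_eq0.
- by move=> [TS0 TS1]; split.
Qed.

(** No two arrows compose to a nonzero map. With [E0], [E1] projecting onto the images of the arrows
    ending in [Y0] and in [Y1], the pair [(1 - E0, E1)] is an idempotent endomorphism that separates
    the two directions. *)
Lemma graded_radical_square_zero n0 n1 (p01 q01 : 'M[k]_(n1, n0)) (p10 q10 : 'M[k]_(n0, n1)) :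
    graded_rel p01 q01 p10 q10 -> graded_indec p01 q01 p10 q10 ->
    q10 *m p01 = 0 -> q01 *m p10 = 0 ->
  (p01 = 0 /\ q01 = 0) \/ (p10 = 0 /\ q10 = 0).
Proof.
move=> [[pp pp'] [qq qq'] qp pq] [_ ind] qp0 qp0'.
have proj m n (A : 'M[k]_(m, n)) : exists E, E *m A = A /\ exists Z, E = A *m Z.
  by exists (A *m pinvmx A); rewrite mulmxKpV //; split=> //; exists (pinvmx A).
have [E1 [E1A [Z1 E1Z]]] := proj _ _ (row_mx p01 q01).
have [E0 [E0A [Z0 E0Z]]] := proj _ _ (row_mx p10 q10).
case/eq_row_mx: (etrans (esym (mul_mx_row _ _ _)) E1A) => E1p E1q.
case/eq_row_mx: (etrans (esym (mul_mx_row _ _ _)) E0A) => E0p E0q.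
have E00 : E0 *m E0 = E0 by rewrite {2 3}E0Z mulmxA E0A.
have E11 : E1 *m E1 = E1 by rewrite {2 3}E1Z mulmxA E1A.
have kill1 m (B : 'M_(m, n1)) : B *m p01 = 0 -> B *m q01 = 0 -> B *m E1 = 0.
  by move=> Bp Bq; rewrite E1Z mulmxA mul_mx_row Bp Bq row_mx0 mul0mx.
have kill0 m (B : 'M_(m, n0)) : B *m p10 = 0 -> B *m q10 = 0 -> B *m E0 = 0.
  by move=> Bp Bq; rewrite E0Z mulmxA mul_mx_row Bp Bq row_mx0 mul0mx.
case: (ind (1%:M - E0) E1) => //.
- by rewrite mulmxBr mulmx1 mulmxBl mul1mx E00 subrr subr0.
- by rewrite E1p mulmxBr mulmx1 kill0 ?subr0 // -pq.
- by rewrite E1q mulmxBr mulmx1 kill0 ?subr0.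
- by rewrite mulmxBl mul1mx E0p subrr kill1 // -qp.
- by rewrite mulmxBl mul1mx E0q subrr kill1.
- by move=> [_ E10]; left; rewrite -E1p -E1q E10 !mul0mx.
- move=> [/eqP]; rewrite -subr_eq0 addrAC subrr sub0r oppr_eq0 => /eqP E_0 _.
  by right; rewrite -E0p -E0q E_0 !mul0mx.
Qed.

Lemma graded_indec_pencil n0 n1 (p01 q01 : 'M[k]_(n1, n0)) :
  graded_indec p01 q01 0 0 <-> pencil_indec p01 q01.
Proof.
split=> -[n_gt0 ind]; split; try by rewrite addnC.
  by move=> F G FF GG Gp Gq; apply: ind; rewrite // mulmx0 mul0mx.
by move=> F G FF GG Gp Gq _ _; apply: ind.
Qed.

Lemma graded_rel_swap n0 n1 (p01 q01 : 'M[k]_(n1, n0)) (p10 q10 : 'M[k]_(n0, n1)) :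
  graded_rel p01 q01 p10 q10 -> graded_rel p10 q10 p01 q01.
Proof. by move=> [[? ?] [? ?] ? ?]. Qed.

Lemma graded_rel_pencil n0 n1 (p01 q01 : 'M[k]_(n1, n0)) : graded_rel p01 q01 0 0.
Proof. by split; rewrite ?mulmx0 ?mul0mx. Qed.

End GradedClass.

Section UmodClass.
Variable k : closedFieldType.
Hypothesis char2 : (2 \in [pchar k])%N.

Lemma umod_class (X : umod k) : is_umod X -> indecomposable X ->
  [\/ umod_iso X (Phi (free_p01 k) (free_q01 k) (free_p10 k) (free_q10 k)),
      umod_iso X (Phi (free_p10 k) (free_q10 k) (free_p01 k) (free_q01 k)) |
      exists n0 n1 (A B : 'M[k]_(n1, n0)), pencil_indec A B /\
        (umod_iso X (Phi A B 0 0) \/ umod_iso X (Phi 0 0 A B))].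
Proof.
move=> uX indX; have [n0 [n1 [p01 [q01 [p10 [q10 [rel isoX]]]]]]] := umod_iso_Phi char2 uX.
have ind := graded_indec_of_Phi char2 rel (iso_indecomposable (iso_sym isoX) indX).
have [qp0|qpn0] := eqVneq (q10 *m p01) 0; last first.
  have [S0 [T0 [S1 [T1 [[? ?] [? ?] [? ?] [? ?]]]]]] := graded_free_split rel ind qpn0.
  apply: Or31; apply: (iso_trans isoX).
  by apply: (Phi_iso (S0 := S0) (S0' := T0) (S1 := S1) (S1' := T1)).
have [pq0|pqn0] := eqVneq (q01 *m p10) 0; last first.
  have [S0 [T0 [S1 [T1 [[? ?] [? ?] [? ?] [? ?]]]]]] :=
    graded_free_split (graded_rel_swap rel) (graded_indec_swap ind) pqn0.
  apply: Or32; apply: (iso_trans isoX).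
  by apply: (Phi_iso (S0 := S1) (S0' := T1) (S1 := S0) (S1' := T0)).
apply: Or33; case: (graded_radical_square_zero rel ind qp0 pq0) => -[? ?]; subst.
  exists n1, n0, p10, q10; split; last by right.
  by apply/graded_indec_pencil/graded_indec_swap.
exists n0, n1, p01, q01; split; last by left.
exact/graded_indec_pencil.
Qed.

Lemma Phi_pencil_iso s w (A B : 'M[k]_(s, w)) s' w' (A' B' : 'M[k]_(s', w')) :
  pencil_equiv A B A' B' ->
  umod_iso (Phi A B 0 0) (Phi A' B' 0 0) /\ umod_iso (Phi 0 0 A B) (Phi 0 0 A' B').
Proof.
move=> [S [T [W [V [[? ?] [? ?] ? ?]]]]]; split.
  by apply: (Phi_iso (S0 := W) (S0' := V) (S1 := S) (S1' := T)); rewrite ?mulmx0 ?mul0mx.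
by apply: (Phi_iso (S0 := S) (S0' := T) (S1 := W) (S1' := V)); rewrite ?mulmx0 ?mul0mx.
Qed.

End UmodClass.

(** * The string and band modules *)

Section Layout.
Variable k : fieldType.

Lemma gen_mod_ext d kap mu nu xi (lam : k) kap' mu' nu' xi' lam' :
    (forall i, (0 < i < d)%N -> kap i = kap' i) ->
    (forall i, (1 < i <= d)%N -> mu i = mu' i) ->
    (forall i, (0 < i <= d)%N -> nu i = nu' i) ->
    (forall i, (0 < i)%N -> (i + 3 <= d)%N ->
      (if xi i then lam else 0) = (if xi' i then lam' else 0)) ->
  gen_mod d kap mu nu xi lam = gen_mod d kap' mu' nu' xi' lam'.
Proof.
move=> kapE muE nuE xiE; congr UMod; apply/matrixP=> i j; rewrite !mxE;
  have lti := ltn_ord i; have ltj := ltn_ord j.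
- by case: eqP => //= E; rewrite kapE //; move: E; lia.
- congr (b2k _ _ + _).
    by case: eqP => //= E; rewrite muE //; move: E; lia.
  by case: eqP => //= E; rewrite xiE //; move: E; lia.
- by case: eqP => //= E; rewrite nuE //; move: E; lia.
Qed.

(* Column j is the basis vector z_(4j+o+1): the string modules are chains of copies of V0
   (one vector) and V1 (three vectors), so each repeats with period four. *)
Definition sel d n (o : nat) : 'M[k]_(d, n) :=
  \matrix_(p < d, j < n) (val p == 4 * val j + o)%N%:R.

Lemma mk_mx_sel d n (o : nat) f : (forall j, j < n -> 4 * j + o < d)%N ->
  mk_mx d f *m sel d n o = \matrix_(p < d, j < n) f p.+1 (4 * j + o).+1%N.
Proof.
move=> lt_d; apply/matrixP=> p j; rewrite !mxE.
have ltj := lt_d _ (ltn_ord j).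
rewrite (bigD1 (Ordinal ltj)) //= big1 => [|l ne].
  by rewrite !mxE eqxx mulr1 addr0.
by rewrite !mxE -(inj_eq val_inj) /= in ne *; rewrite (negbTE ne) mulr0.
Qed.

(** The matrices concerned have at most one 1 in each column: [ok] says whether there is one, and
    [tau] in which row. *)
Lemma sel_mul d s w (o : nat) (c : nat -> nat -> bool) (ok : pred nat) (tau : nat -> nat) :
    (forall i j, c i j = ok j && (i == tau j)) ->
  sel d s o *m (\matrix_(i < s, j < w) (c i j)%:R) =
  \matrix_(p < d, j < w) (ok j && (tau j < s) && (val p == 4 * tau j + o))%N%:R.
Proof.
move=> cE; apply/matrixP=> p j; rewrite !mxE; case: ltnP => [lt_s|le_s]; last first.
  rewrite andbF big1 // => i _; rewrite !mxE cE.
  case: (nat_of_ord i =P tau j) => [E|]; rewrite ?andbF ?mulr0 //.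
  by move: le_s; rewrite -E leqNgt ltn_ord.
rewrite andbT (bigD1 (Ordinal lt_s)) //= big1 => [|i].
  by rewrite !mxE cE eqxx andbT addr0 mulrC -natrM mulnb.
by rewrite -(inj_eq val_inj) !mxE cE /= => /negbTE ->; rewrite andbF mulr0.
Qed.

Lemma sel_T2A d s w o : sel d s o *m T2A k s w =
  \matrix_(p < d, j < w) ((j.+1 < s) && (val p == 4 * j.+1 + o))%N%:R.
Proof. exact: (@sel_mul _ _ _ _ (fun i j => i == j.+1) xpredT S). Qed.

Lemma sel_T2B d s w o : sel d s o *m T2B k s w =
  \matrix_(p < d, j < w) ((j < s) && (val p == 4 * j + o))%N%:R.
Proof. exact: (@sel_mul _ _ _ _ (fun i j => i == j) xpredT id). Qed.

Lemma sel_T1A d s w o : sel d s o *m T1A k s w =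
  \matrix_(p < d, j < w) ((j < s) && (val p == 4 * j + o))%N%:R.
Proof. exact: (@sel_mul _ _ _ _ (fun i j => i == j) xpredT id). Qed.

Lemma sel_T1B d s w o lam : sel d s o *m T1B lam s w =
  \matrix_(p < d, j < w) ((0 < j) && (j.-1 < s) && (val p == 4 * j.-1 + o))%N%:R
  + lam *: \matrix_(p < d, j < w) ((j < s) && (val p == 4 * j + o))%N%:R.
Proof.
have -> : T1B lam s w = \matrix_(i < s, j < w) (i.+1 == j)%N%:R + lam *: T1A k s w.
  by apply/matrixP=> i j; rewrite !mxE mulr_natr.
rewrite mulmxDr -scalemxAr sel_T1A; congr (_ + _).
apply: (@sel_mul _ _ _ _ (fun i j => i.+1 == j) (leq 1) predn) => i [|j] //.
Qed.

Lemma selT_sel d n m (o o' : nat) : (o < 4)%N -> (o' < 4)%N ->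
    (forall j, j < n -> 4 * j + o < d)%N ->
  (sel d n o)^T *m sel d m o' = \matrix_(i, j) ((o == o') && (i == j :> nat))%:R.
Proof.
move=> o4 o'4 lt_d; apply/matrixP=> i j; rewrite !mxE.
have lti := lt_d _ (ltn_ord i).
rewrite (bigD1 (Ordinal lti)) //= big1 => [|l ne].
  rewrite !mxE eqxx mul1r addr0; congr (_%:R); congr nat_of_bool.
  rewrite /=; by apply/idP/idP; lia.
by rewrite !mxE -(inj_eq val_inj) /= in ne *; rewrite (negbTE ne) mul0r.
Qed.

Lemma mulmx_rev1 m n (F : 'M[k]_(m, n)) (G : 'M_(n, m)) :
  m = n -> G *m F = 1%:M -> F *m G = 1%:M.
Proof. by move=> e; subst m; apply: mulmx1C. Qed.

(** The four blocks [s0], [s1], [sa], [sb] are bases of [Y0], [Y1], [a Y1], [b Y1] inside [L]; by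
    equality of dimensions a left inverse suffices. *)
Lemma Phi_intro (L : umod k) n0 n1 (p01 q01 : 'M[k]_(n1, n0)) (p10 q10 : 'M[k]_(n0, n1))
    (s0 : 'M_(udim L, n0)) (s1 sa sb : 'M_(udim L, n1))
    (G : 'M_(n0 + n1 + (n1 + n1), udim L)) :
    udim L = (n0 + n1 + (n1 + n1))%N ->
    [/\ ua L *m s0 = sb *m p01, ua L *m s1 = sa, ua L *m sa = s0 *m p10
      & ua L *m sb = s1 *m (1%:M + p01 *m q10)] ->
    [/\ ub L *m s0 = sa *m q01, ub L *m s1 = sb,
        ub L *m sa = s1 *m (1%:M + p01 *m q10) & ub L *m sb = s0 *m q10] ->
    [/\ uc L *m s0 = 0, uc L *m s1 = 0, uc L *m sa = sa & uc L *m sb = sb] ->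
    G *m row_mx (row_mx s0 s1) (row_mx sa sb) = 1%:M ->
  umod_iso L (Phi p01 q01 p10 q10).
Proof.
move=> dimE [a0 a1 aa ab] [b0 b1 ba bb] [c0 c1 ca cb] GF.
pose F : 'M[k]_(udim L, udim (Phi p01 q01 p10 q10)) := row_mx (row_mx s0 s1) (row_mx sa sb).
apply: iso_sym; apply: (@iso_intro _ _ _ F G) => //; last exact: mulmx_rev1.
split; rewrite /F /= !mul_row_block ?mul_mx_row ?(mulmx0, add0r, addr0)
    ?mul_row_block ?mul_mx_row ?(mulmx0, add0r, addr0, mulmx1).
- by rewrite a0 a1 aa ab.
- by rewrite b0 b1 ba bb.
- by rewrite c0 c1 ca cb row_mx0.
Qed.

(** For a pencil [p01 q10 = 0], so [T = 1]. The blocks pick basis vectors of [L] by residue modulo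
    4, and distinct residues make the transpose a left inverse. *)
Lemma layout_iso (L : umod k) n0 n1 (o0 o1 oa ob : nat)
    (p01 q01 : 'M[k]_(n1, n0)) (p10 q10 : 'M[k]_(n0, n1)) :
    uniq [:: o0; o1; oa; ob] -> all (fun o => o < 4)%N [:: o0; o1; oa; ob] ->
    udim L = (n0 + n1 + (n1 + n1))%N ->
    (forall j, j < n0 -> 4 * j + o0 < udim L)%N ->
    (forall j, j < n1 -> [/\ 4 * j + o1 < udim L, 4 * j + oa < udim L & 4 * j + ob < udim L])%N ->
    let s0 := sel (udim L) n0 o0 in let s1 := sel (udim L) n1 o1 in
    let sa := sel (udim L) n1 oa in let sb := sel (udim L) n1 ob in
    p01 *m q10 = 0 ->
    [/\ ua L *m s0 = sb *m p01, ua L *m s1 = sa, ua L *m sa = s0 *m p10 & ua L *m sb = s1] ->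
    [/\ ub L *m s0 = sa *m q01, ub L *m s1 = sb, ub L *m sa = s1 & ub L *m sb = s0 *m q10] ->
    [/\ uc L *m s0 = 0, uc L *m s1 = 0, uc L *m sa = sa & uc L *m sb = sb] ->
  umod_iso L (Phi p01 q01 p10 q10).
Proof.
move=> /= uo /and5P[lo0 lo1 loa lob _] dimE r0 r1 pq [a0 a1 aa ab] [b0 b1 ba bb] [c0 c1 ca cb].
have r11 j : (j < n1 -> 4 * j + o1 < udim L)%N by case/r1.
have r1a j : (j < n1 -> 4 * j + oa < udim L)%N by case/r1.
have r1b j : (j < n1 -> 4 * j + ob < udim L)%N by case/r1.
set s0 := sel _ n0 o0 in a0 aa b0 bb c0; set s1 := sel _ n1 o1 in a1 ab b1 ba c1.
set sa := sel _ n1 oa in a1 aa b0 ba ca; set sb := sel _ n1 ob in a0 ab b1 bb cb.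
pose F := row_mx (row_mx s0 s1) (row_mx sa sb).
have FF : F^T *m F = 1%:M.
  rewrite /F !tr_row_mx !mul_col_row !selT_sel // !eqxx /=.
  have {uo} [[n1_ n2 n3] [n4 n5 n6]] : [/\ o0 != o1, o0 != oa & o0 != ob] /\
      [/\ o1 != oa, o1 != ob & oa != ob].
    by move: uo; rewrite /= !inE !negb_or !andbT => /and3P[/and3P[-> -> ->] /andP[-> ->] ->].
  have z m n (b : bool) : b = false ->
      \matrix_(i < m, j < n) (b && (i == j :> nat))%:R = 0 :> 'M[k]_(m, n).
    by move=> ->; apply/matrixP=> i j; rewrite !mxE.
  have e n : \matrix_(i < n, j < n) (i == j :> nat)%:R = 1%:M :> 'M[k]_n.
    by apply/matrixP=> i j; rewrite !mxE.
  rewrite !e !z ?block_mx0 -?scalar_mx_block //; by apply/negbTE; rewrite // eq_sym.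
by apply: Phi_intro FF; rewrite // pq addr0 mulmx1.
Qed.

End Layout.

(** * Strings and bands as standard pencils *)

Section Families.
Variable k : fieldType.

(** The exceptions at the last index in the lists concern vectors outside the basis. Each family is
    thus one rule read at varying length [d]: [fam1] covers [U1], [Vs1], [Aband]; [fam2] covers
    [U2], [Vs2]; [fam3] covers [U3], [W1], [Bband]; [fam4] covers [U4], [W2]. Strings have
    [lam = 0]. *)
Definition fam1 d (lam : k) := gen_mod d (fun i => ~~ (i %% 4 == 0)%N)
  (fun i => ~~ ((i %% 4 == 2) || (i == 1))%N) nu_ev xi_band lam.
Definition fam2 d : umod k := string_mod k d (fun i => ~~ (i %% 4 == 3)%N)
  (fun i => ~~ (i %% 4 == 1)%N) nu_od.
Definition fam3 d (lam : k) := gen_mod d (fun i => ~~ (i %% 4 == 0)%N)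
  (fun i => ~~ ((i %% 4 == 0) || (i == 1))%N) nu_od xi_band lam.
Definition fam4 d : umod k := string_mod k d (fun i => ~~ (i %% 4 == 1)%N)
  (fun i => ~~ (i %% 4 == 1)%N) nu_ev.

Let entry_a (b b' : bool) : b = b' -> b2k k b = b'%:R.
Proof. by move=> ->; case: b'. Qed.

Let entry_a0 (b : bool) : b = false -> b2k k b = 0.
Proof. by move=> ->. Qed.

Let entry_b (b b' c c' : bool) (lam : k) : b = b' -> c = c' ->
  b2k k b + (if c then lam else 0) = b'%:R + lam * c'%:R.
Proof. by move=> -> ->; case: b'; case: c'; rewrite ?mulr1 ?mulr0. Qed.

Let entry_b1 (b b' c : bool) (lam : k) : b = b' -> c = false ->
  b2k k b + (if c then lam else 0) = b'%:R.
Proof. by move=> -> ->; case: b'; rewrite addr0. Qed.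

Let entry_b0 (b c : bool) (lam : k) : b = false -> c = false ->
  b2k k b + (if c then lam else 0) = 0.
Proof. by move=> -> ->; rewrite addr0. Qed.

(** Both sides are given entrywise by conditions on indices modulo 4, so comparing entries leaves
    boolean identities for [lia]. *)
Ltac entries := 
  rewrite mk_mx_sel; [ | by move=> *; lia];
  rewrite ?mulmx0 ?sel_T1A ?sel_T1B ?sel_T2A ?sel_T2B;
  let p := fresh "p" in let j := fresh "j" in
  apply/matrixP=> p j;
  have ? := ltn_ord p; have ? := ltn_ord j;
  rewrite !mxE /nu_ev /nu_od /xi_band;
  first [apply: entry_a | apply: entry_a0 | apply: entry_b | apply: entry_b1 | apply: entry_b0];
  rewrite /=; lia.

(** A period starts with a copy of [V0], offset 0, followed by a copy of [V1] whose middle vector,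
    offset 2, lies in [Y1]; [b] and [a] lead from it to offsets 1 and 3. The arrow [P] is read from
    [a z_(4j+1) = z_(4j+2)], and [Q] from [b z_(4j+1) = z_(4j) + lam z_(4j+4)]. *)
Lemma fam1_iso s w lam : (s <= w <= s.+1)%N ->
  umod_iso (fam1 (w + s + (s + s)) lam) (Phi (T1A k s w) (T1B lam s w) 0 0).
Proof.
move=> le_sw; apply: (@layout_iso _ (fam1 _ lam) _ _ 0 2 3 1) => //=.
- by lia.
- by move=> j ltj; split; lia.
- by rewrite mulmx0.
- split; entries.
- split; entries.
- split; entries.
Qed.

Lemma fam2_iso s w : (w <= s <= w.+1)%N ->
  umod_iso (fam2 (w + s + (s + s))) (Phi (T2A k s w) (T2B k s w) 0 0).
Proof.
(* Here the copy of [V1] comes first in each period, with middle vector at offset 1, and [V0]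
   last. *)
move=> le_ws; apply: (@layout_iso _ (fam2 _) _ _ 3 1 2 0) => //=.
- by move=> j ltj; lia.
- by move=> j ltj; split; lia.
- by rewrite mulmx0.
- split; entries.
- split; entries.
- split; entries.
Qed.

Lemma fam3_iso s w lam : (s <= w <= s.+1)%N ->
  umod_iso (fam3 (s + w + (w + w)) lam) (Phi 0 0 (T1A k s w) (T1B lam s w)).
Proof.
move=> le_sw; apply: (@layout_iso _ (fam3 _ lam) _ _ 3 1 2 0) => //=.
- by move=> j ltj; lia.
- by move=> j ltj; split; lia.
- by rewrite mul0mx.
- split; entries.
- split; entries.
- split; entries.
Qed.

Lemma fam4_iso s w : (w <= s <= w.+1)%N ->
  umod_iso (fam4 (s + w + (w + w))) (Phi 0 0 (T2A k s w) (T2B k s w)).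
Proof.
move=> le_ws; apply: (@layout_iso _ (fam4 _) _ _ 0 2 3 1) => //=.
- by lia.
- by move=> j ltj; split; lia.
- by rewrite mul0mx.
- split; entries.
- split; entries.
- split; entries.
Qed.

Lemma U1E r : U1 k r = fam1 (r.+1 + r + (r + r)) 0.
Proof.
rewrite /fam1 (_ : r.+1 + r + (r + r) = 4 * r + 1)%N; last by lia.
by apply: gen_mod_ext => // i *; rewrite ?if_same //; lia.
Qed.

Lemma U2E r : U2 k r = fam2 (r + r.+1 + (r.+1 + r.+1)).
Proof. by congr string_mod; lia. Qed.

Lemma U3E r : U3 k r = fam3 (r + r.+1 + (r.+1 + r.+1)) 0.
Proof.
rewrite /fam3 (_ : r + r.+1 + (r.+1 + r.+1) = 4 * r + 3)%N; last by lia.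
by apply: gen_mod_ext => // i *; rewrite ?if_same //; lia.
Qed.

Lemma U4E r : U4 k r = fam4 (r.+1 + r + (r + r)).
Proof. by congr string_mod; lia. Qed.

Lemma Vs1E t : Vs1 k t = fam1 (t.+1 + t.+1 + (t.+1 + t.+1)) 0.
Proof.
rewrite /fam1 (_ : t.+1 + t.+1 + (t.+1 + t.+1) = 4 * t.+1)%N; last by lia.
by apply: gen_mod_ext => // i *; rewrite ?if_same.
Qed.

Lemma Vs2E t : Vs2 k t = fam2 (t.+1 + t.+1 + (t.+1 + t.+1)).
Proof.
rewrite /fam2 (_ : t.+1 + t.+1 + (t.+1 + t.+1) = 4 * t.+1)%N; last by lia.
by apply: gen_mod_ext => // i *; rewrite ?if_same //; lia.
Qed.

Lemma W1E t : W1 k t = fam3 (t.+1 + t.+1 + (t.+1 + t.+1)) 0.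
Proof.
rewrite /fam3 (_ : t.+1 + t.+1 + (t.+1 + t.+1) = 4 * t.+1)%N; last by lia.
by apply: gen_mod_ext => // i *; rewrite ?if_same //; lia.
Qed.

Lemma W2E t : W2 k t = fam4 (t.+1 + t.+1 + (t.+1 + t.+1)).
Proof.
rewrite /fam4 (_ : t.+1 + t.+1 + (t.+1 + t.+1) = 4 * t.+1)%N; last by lia.
by apply: gen_mod_ext => // i *; rewrite ?if_same //; lia.
Qed.

Lemma AbandE lam n : Aband lam n = fam1 (n + n + (n + n)) lam.
Proof. by rewrite /fam1 (_ : n + n + (n + n) = 4 * n)%N; last by lia. Qed.

Lemma BbandE lam n : Bband lam n = fam3 (n + n + (n + n)) lam.
Proof. by rewrite /fam3 (_ : n + n + (n + n) = 4 * n)%N; last by lia. Qed.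

(** The simple modules are the pencils with one space zero and the other a line; they occur for both
    directions of the arrows, hence two descriptions of each. *)
Lemma V1E : V1 k = fam2 (0 + 1 + (1 + 1)).
Proof. by apply: gen_mod_ext => // i *; rewrite ?if_same //; lia. Qed.

Lemma V1E' : V1 k = fam3 (0 + 1 + (1 + 1)) 0.
Proof. by apply: gen_mod_ext => // i *; rewrite ?if_same //; lia. Qed.

Lemma V0E : V0 k = fam1 (1 + 0 + (0 + 0)) 0.
Proof. by congr UMod; apply/matrixP=> i j; rewrite !mxE !ord1 //= addr0. Qed.

Lemma V0E' : V0 k = fam4 (1 + 0 + (0 + 0)).
Proof. by congr UMod; apply/matrixP=> i j; rewrite !mxE !ord1 //= addr0. Qed.

End Families.

(** * Indecomposability of the standard pencils *)

Section StandardIndec.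
Variable k : fieldType.

Lemma mulmx_pickr m n p (M : 'M[k]_(m, n)) (N : 'M_(n, p)) i j (l : 'I_n) :
  (forall l', l' != l -> N l' j = 0) -> (M *m N) i j = M i l * N l j.
Proof.
move=> Nj; rewrite mxE (bigD1 l) //= big1 ?addr0 // => l' ne.
by rewrite Nj // mulr0.
Qed.

Lemma mulmx_pickl m n p (M : 'M[k]_(m, n)) (N : 'M_(n, p)) i j (l : 'I_n) :
  (forall l', l' != l -> M i l' = 0) -> (M *m N) i j = M i l * N l j.
Proof.
move=> Mi; rewrite mxE (bigD1 l) //= big1 ?addr0 // => l' ne.
by rewrite Mi // mul0r.
Qed.

(** The diagonal entry is itself idempotent, so 0 or 1. Accordingly [F] or [1 - F] is a strictly
    triangular idempotent, hence nilpotent and zero. *)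
Lemma triangular_idempotent n (F : 'M[k]_n) c : F *m F = F ->
  (forall i j : 'I_n, (j < i)%N -> F i j = 0) -> (forall i, F i i = c) ->
  F = 0 \/ F = 1%:M.
Proof.
have nil (N : 'M[k]_n) : N *m N = N -> (forall i j : 'I_n, (j <= i)%N -> N i j = 0) -> N = 0.
  move=> NN Nlow; suff H m (i j : 'I_n) : (j < i + m)%N -> N i j = 0.
    by apply/matrixP=> i j; rewrite mxE (H n) // ltn_addl.
  elim: m i j => [|m IH] i j lt_j; first by rewrite Nlow //; lia.
  rewrite -NN mxE big1 // => l _; have [lt_l|le_l] := ltnP l (i + m).
    by rewrite IH ?mul0r.
  by rewrite (Nlow l j) ?mulr0 //; lia.
case: n nil F => [|n] nil F FF Flow Fdiag; first by left; rewrite [F]flatmx0.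
have cc : c * c = c.
  rewrite -{3}(Fdiag 0) -FF (@mulmx_pickr _ _ _ _ _ _ _ (0)) ?Fdiag // => l ne.
  by apply: Flow; rewrite lt0n.
have : c * (c - 1) == 0 by rewrite mulrBr mulr1 cc subrr.
rewrite mulf_eq0 subr_eq0 => /orP[] /eqP cE; [left|right].
  apply: nil => // i j; rewrite leq_eqVlt => /orP[/eqP/val_inj ->|/Flow //].
  by rewrite Fdiag.
apply/eqP; rewrite eq_sym -subr_eq0; apply/eqP; apply: nil.
  by rewrite mulmxBr mulmx1 mulmxBl mul1mx FF subrr subr0.
move=> i j; rewrite leq_eqVlt !mxE => /orP[/eqP/val_inj ->|lt_ji].
  by rewrite Fdiag eqxx cE subrr.
by rewrite Flow // -(inj_eq val_inj) gtn_eqF ?subr0.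
Qed.

(** Subtracting [lam] times the first matrix replaces [T1B] by the shift [U]. The first matrix
    identifies [G] with a corner of [F], and commuting with [U] makes [F] constant along diagonals
    and zero below the main one. *)
Lemma T1_indec s w (lam : k) : (s <= w <= s.+1)%N -> (0 < w)%N ->
  pencil_indec (T1A k s w) (T1B lam s w).
Proof.
move=> le_sw w_gt0; split; first by lia.
move=> F G FF GG GA GB; have /andP[le_sw1 le_ws] := le_sw.
pose ws := widen_ord le_sw1.
have rowF (i j : 'I_s) : F (ws i) (ws j) = G i j.
  have /matrixP/(_ i (ws j)) := GA.
  rewrite (@mulmx_pickr _ _ _ _ _ _ _ j) => [|l ne]; last first.
    by rewrite !mxE /= (inj_eq val_inj) (negbTE ne).
  rewrite (@mulmx_pickl _ _ _ _ _ _ _ (ws i)) => [|l ne].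
    by rewrite !mxE !eqxx mulr1 mul1r.
  by rewrite !mxE /= eq_sym; rewrite -(inj_eq val_inj) /= in ne; rewrite (negbTE ne).
pose U : 'M[k]_(s, w) := \matrix_(i < s, j < w) (i.+1 == j)%N%:R.
have GU : G *m U = U *m F.
  have T1BE : T1B lam s w = U + lam *: T1A k s w.
    by apply/matrixP=> i j; rewrite !mxE mulr_natr.
  by move: GB; rewrite T1BE mulmxDr mulmxDl -scalemxAr -scalemxAl GA => /addIr.
have UF (i : 'I_s) (i' j : 'I_w) : i' = i.+1 :> nat -> (U *m F) i j = F i' j.
  move=> E; rewrite (@mulmx_pickl _ _ _ _ _ _ _ i') => [|l ne].
    by rewrite !mxE E eqxx mul1r.
  by rewrite !mxE -E eq_sym (inj_eq val_inj) (negbTE ne).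
have GU0 (i : 'I_s) (j : 'I_w) : j = 0%N :> nat -> (G *m U) i j = 0.
  by move=> E; rewrite mxE big1 // => l _; rewrite !mxE E mulr0.
have GUS (i j' : 'I_s) (j : 'I_w) : j = j'.+1 :> nat -> (G *m U) i j = G i j'.
  move=> E; rewrite (@mulmx_pickr _ _ _ _ _ _ _ j') => [|l ne].
    by rewrite !mxE E eqxx mulr1.
  by rewrite !mxE E eqSS (inj_eq val_inj) (negbTE ne).
have prev (i : 'I_w) m : i = m.+1 :> nat -> exists i' : 'I_s, i' = m :> nat.
  move=> E; have lt_ms : (m < s)%N by rewrite -ltnS -E (leq_trans (ltn_ord i)).
  by exists (Ordinal lt_ms).
have Flow (i j : 'I_w) : (j < i)%N -> F i j = 0.
  have [m] := ubnP i; elim: m i j => // m IH i j lt_im lt_ji.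
  case iE: (nat_of_ord i) => [|i0]; first by lia.
  have [i' i'E] := prev _ _ iE; rewrite -(UF i') ?i'E // -GU.
  case jE: (nat_of_ord j) => [|j0]; first by rewrite GU0.
  have [j' j'E] := prev _ _ jE; rewrite (GUS _ j') ?j'E // -rowF IH //=;
    by lia.
have Fdiag (i : 'I_w) : F i i = F (Ordinal w_gt0) (Ordinal w_gt0).
  have [m] := ubnP i; elim: m i => // m IH i lt_im.
  case iE: (nat_of_ord i) => [|i0].
    by rewrite (_ : i = Ordinal w_gt0) //; apply: val_inj.
  have [i' i'E] := prev _ _ iE; rewrite -{1}(UF i') ?i'E // -GU (GUS _ i') ?i'E //.
  by rewrite -rowF IH //=; lia.
case: (triangular_idempotent FF Flow Fdiag) => FE; [left|right]; split=> //.
  by apply/matrixP=> i j; rewrite -rowF FE !mxE.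
by apply/matrixP=> i j; rewrite -rowF FE !mxE -(inj_eq val_inj).
Qed.

(** These are the transposed [T1] pencils for [lam = 0] with the two matrices exchanged. *)
Lemma T2_indec s w : (w <= s <= w.+1)%N -> (0 < s)%N ->
  pencil_indec (T2A k s w) (T2B k s w).
Proof.
move=> le_ws s_gt0; have : pencil_indec (T1A k w s) (T1B 0 w s) by apply: T1_indec.
move/pencil_indec_tr.
have -> : (T1A k w s)^T = T2B k s w by apply/matrixP=> i j; rewrite !mxE eq_sym.
have -> : (T1B 0 w s)^T = T2A k s w.
  by apply/matrixP=> i j; rewrite !mxE mul0rn addr0 eq_sym.
by move=> [n_gt0 ind]; split=> // F G FF GG GA GB; apply: ind.
Qed.

End StandardIndec.

(** * Computing with 0/1 matrices in characteristic two *)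

Section BoolMatrices.
Variable k : fieldType.
Hypothesis char2 : (2 \in [pchar k])%N.

Definition bmx m n (f : nat -> nat -> bool) : 'M[k]_(m, n) :=
  \matrix_(i < m, j < n) b2k k (f i.+1 j.+1).

(* The product is tabulated so that iterated products evaluate in polynomial time. *)
Definition btab m n (f : nat -> nat -> bool) : nat -> nat -> bool :=
  let t := [seq [seq f i j | j <- iota 1 n] | i <- iota 1 m] in
  fun i j => nth false (nth [::] t i.-1) j.-1.

Definition bmul m n p (f g : nat -> nat -> bool) : nat -> nat -> bool :=
  btab m p (fun i j => foldr (fun l b => (f i l && g l j) (+) b) false (iota 1 n)).

Definition badd m n (f g : nat -> nat -> bool) : nat -> nat -> bool :=
  btab m n (fun i j => f i j (+) g i j).

Definition beq m n (f g : nat -> nat -> bool) : bool :=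
  all (fun i => all (fun j => f i j == g i j) (iota 1 n)) (iota 1 m).

Lemma b2k_add (a b : bool) : b2k k (a (+) b) = b2k k a + b2k k b.
Proof. by case: a; case: b; rewrite /= ?addr0 ?add0r // addrr_pchar2. Qed.

Lemma b2k_mul (a b : bool) : b2k k (a && b) = b2k k a * b2k k b.
Proof. by case: a; case: b; rewrite /= ?mulr1 ?mulr0. Qed.

Lemma bmx_eq m n f g : beq m n f g -> bmx m n f = bmx m n g.
Proof.
move/allP=> E; apply/matrixP=> i j; rewrite !mxE.
have /E/allP/(_ j.+1) : i.+1 \in iota 1 m by rewrite mem_iota /= add1n ltnS ltn_ord.
by rewrite mem_iota /= add1n ltnS ltn_ord => /(_ isT)/eqP ->.
Qed.

Lemma btabE m n f : bmx m n (btab m n f) = bmx m n f.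
Proof.
apply/matrixP=> i j; rewrite !mxE /btab /=; congr (b2k k _).
by rewrite (nth_map 0) ?size_iota // (nth_map 0) ?size_iota // !nth_iota.
Qed.

Lemma bmxM m n p f g : bmx m n f *m bmx n p g = bmx m p (bmul m n p f g).
Proof.
rewrite btabE; apply/matrixP=> i j; rewrite !mxE.
transitivity (\sum_(1 <= l < n.+1) b2k k (f i.+1 l) * b2k k (g l j.+1)).
  by rewrite big_add1 big_mkord; apply: eq_bigr => l _; rewrite !mxE.
rewrite /index_iota subSS subn0; elim: (iota 1 n) => [|l s IH] /=; first by rewrite big_nil.
by rewrite big_cons IH b2k_add b2k_mul.
Qed.

Lemma bmxD m n f g : bmx m n f + bmx m n g = bmx m n (badd m n f g).
Proof. by rewrite btabE; apply/matrixP=> i j; rewrite !mxE b2k_add. Qed.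

Lemma bmx1 n : bmx n n (fun i j => i == j) = 1%:M.
Proof. by apply/matrixP=> i j; rewrite !mxE eqSS (inj_eq val_inj); case: eqP. Qed.

Lemma bmx0 m n : bmx m n (fun _ _ => false) = 0.
Proof. by apply/matrixP=> i j; rewrite !mxE. Qed.

Lemma bmx_tr m n f : (bmx m n f)^T = bmx n m (fun i j => f j i).
Proof. by apply/matrixP=> i j; rewrite !mxE. Qed.


Section Words.
Variables (d : nat) (fa fb fc : nat -> nat -> bool).

Definition bletter (g : nat) := match g with 0 => fa | 1 => fb | _ => fc end%N.

Definition bword (w : seq nat) : nat -> nat -> bool :=
  foldr (fun g f => bmul d d d (bletter g) f) (btab d d (fun i j => i == j)) w.

Definition bpoly (p : seq (seq nat)) : nat -> nat -> bool :=
  foldr (fun w f => badd d d (bword w) f) (btab d d (fun _ _ => false)) p.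

Let X := @UMod k d (bmx d d fa) (bmx d d fb) (bmx d d fc).

Lemma bletterE g : letter X g = bmx d d (bletter g).
Proof. by case: g => [|[]]. Qed.

Lemma bpolyE p : pval X p = bmx d d (bpoly p).
Proof.
elim: p => [|w p IH]; first by rewrite pval_nil btabE bmx0.
rewrite pval_cons IH /= -bmxD; congr (_ + _).
elim: w {p IH} => [|g w IH] /=; first by rewrite btabE bmx1.
by rewrite IH bletterE bmxM.
Qed.

End Words.

End BoolMatrices.

Section ConcreteModules.
Variable k : fieldType.
Hypothesis char2 : (2 \in [pchar k])%N.

Definition aMN_b (p q : nat) : bool := (p == q.+1) && (q \in [:: 1; 2; 3; 5; 6; 7]%N).
Definition bM_b (p q : nat) : bool :=
  (p, q) \in [:: (1,2); (2,3); (3,5); (4,6); (6,7); (7,8)]%N.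
Definition cM_b (p q : nat) : bool := (p == q) && (q \in [:: 1; 3; 6; 8]%N).
Definition bN_b (p q : nat) : bool :=
  (p, q) \in [:: (2,3); (3,4); (1,5); (4,8); (2,6); (5,6); (3,7); (6,7)]%N.
Definition cN_b (p q : nat) : bool := (p == q) && (q \in [:: 2; 4; 5; 7]%N).

Definition M_b : umod k := @UMod k 8 (bmx k 8 8 aMN_b) (bmx k 8 8 bM_b) (bmx k 8 8 cM_b).
Definition N_b : umod k := @UMod k 8 (bmx k 8 8 aMN_b) (bmx k 8 8 bN_b) (bmx k 8 8 cN_b).

Lemma MmodE : Mmod k = M_b. Proof. by []. Qed.
Lemma NmodE : Nmod k = N_b. Proof. by []. Qed.

Lemma free_p01E : free_p01 k = bmx k 2 2 (fun i j => (i, j) == (1, 1)%N).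
Proof.
apply/matrixP=> i j; case: (split_ordP i) => i' ->; case: (split_ordP j) => j' ->;
  by rewrite !ord1 ?(block_mxEul, block_mxEur, block_mxEdl, block_mxEdr) !mxE.
Qed.

Lemma free_q01E : free_q01 k = bmx k 2 2 (fun i j => (i, j) == (2, 1)%N).
Proof.
apply/matrixP=> i j; case: (split_ordP i) => i' ->; case: (split_ordP j) => j' ->;
  by rewrite !ord1 ?(block_mxEul, block_mxEur, block_mxEdl, block_mxEdr) !mxE.
Qed.

Lemma free_p10E : free_p10 k = bmx k 2 2 (fun i j => (i, j) == (2, 2)%N).
Proof.
apply/matrixP=> i j; case: (split_ordP i) => i' ->; case: (split_ordP j) => j' ->;
  by rewrite !ord1 ?(block_mxEul, block_mxEur, block_mxEdl, block_mxEdr) !mxE.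
Qed.

Lemma free_q10E : free_q10 k = bmx k 2 2 (fun i j => (i, j) == (2, 1)%N).
Proof. exact: free_q01E. Qed.

Ltac bcheck := rewrite /= ?(free_p01E, free_q01E, free_p10E, free_q10E) ?(bmxM char2)
  -?(bmx0 k) -?(bmx1 k) ?(bmxD char2) ?(bmxM char2); apply: bmx_eq; vm_compute; reflexivity.

Ltac bcheck_inverse := rewrite !mul_col_row !(bmxM char2);
  rewrite [RHS]scalar_mx_block !(@scalar_mx_block _ 2 2) -!(@block_mx0 _ 2 2 2 2);
  congr (block_mx (block_mx _ _ _ _) (block_mx _ _ _ _) (block_mx _ _ _ _) (block_mx _ _ _ _));
  bcheck.

Lemma Mmod_iso : umod_iso (Mmod k) (Phi (free_p01 k) (free_q01 k) (free_p10 k) (free_q10 k)).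
Proof.
rewrite MmodE; pose s (p q : nat) := bmx k 8 2 (fun i j => (i, j) \in [:: (p, 1); (q, 2)]%N).
pose r (p q : nat) := bmx k 2 8 (fun i j => (j, i) \in [:: (p, 1); (q, 2)]%N).
(* The generator is [w_1], with [P w_1 = w_3], [Q w_1 = v_2], [PQ w_1 = v_4]; the last two blocks
   are [a] and [b] applied to [w_3], [v_2]. *)
apply: (@Phi_intro _ M_b 2 2 _ _ _ _ (s 5 4) (s 7 2) (s 8 3) (s 6 1)
  (col_mx (col_mx (r 5 4) (r 7 2)) (col_mx (r 8 3) (r 6 1)))).
- by [].
- rewrite /s; split; bcheck.
- rewrite /s; split; bcheck.
- rewrite /s; split; bcheck.
- rewrite /s /r; bcheck_inverse.
Qed.

Lemma Nmod_iso : umod_iso (Nmod k) (Phi (free_p10 k) (free_q10 k) (free_p01 k) (free_q01 k)).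
Proof.
rewrite NmodE; pose s (p q : nat) := bmx k 8 2 (fun i j => (i, j) \in [:: (p, 1); (q, 2)]%N).
pose r (p q : nat) := bmx k 2 8 (fun i j => (j, i) \in [:: (p, 1); (q, 2)]%N).
pose sb := bmx k 8 2 (fun i j => (i, j) \in [:: (2, 1); (5, 1); (2, 2)]%N).
pose rb := bmx k 2 8 (fun i j => (j, i) \in [:: (5, 1); (2, 2); (5, 2)]%N).
(* The generator is now [w_2] in [Y1], with [P w_2 = w_4], [Q w_2 = v_1], [PQ w_2 = v_3]. As
   [b w_2 = v_2 + w_1] is not a basis vector, the last block and its inverse are the separate [sb]
   and [rb]. *)
apply: (@Phi_intro _ N_b 2 2 _ _ _ _ (s 8 1) (s 6 3) (s 7 4) sb
  (col_mx (col_mx (r 8 1) (r 6 3)) (col_mx (r 7 4) rb))).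
- by [].
- rewrite /s /sb; split; bcheck.
- rewrite /s /sb; split; bcheck.
- rewrite /s /sb; split; bcheck.
- rewrite /s /sb /r /rb; bcheck_inverse.
Qed.

Lemma free_rel : graded_rel (free_p01 k) (free_q01 k) (free_p10 k) (free_q10 k).
Proof. by split; [split|split| |]; bcheck. Qed.

(** An endomorphism of a cyclic module is determined on the generator; it is scalar plus nilpotent
    here, so an idempotent one is 0 or 1. *)
Lemma free_indec : graded_indec (free_p01 k) (free_q01 k) (free_p10 k) (free_q10 k).
Proof.
split=> // F0 F1 F00 F11.
rewrite -[F0]submxK -[F1]submxK in F00 F11 *.
move: (ulsubmx F0) (ursubmx F0) (dlsubmx F0) (drsubmx F0) F00 => a b c d F00.
move: (ulsubmx F1) (ursubmx F1) (dlsubmx F1) (drsubmx F1) F11 => a' b' c' d' F11.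
rewrite !mulmx_block !(mul0mx, mulmx0, mul1mx, mulmx1, add0r, addr0).
case/eq_block_mx=> E1 E2 E3 E4; case/eq_block_mx=> E5 E6 E7 E8.
case/eq_block_mx=> E9 E10 E11 E12; case/eq_block_mx=> E13 E14 E15 E16.
move: F00; rewrite -E2 E12 E7 E1 E3 E5 !mulmx_block !(mul0mx, mulmx0, add0r, addr0).
case/eq_block_mx=> aa _ ca _; move: aa ca; rewrite [a]mx11_scalar -scalar_mxM.
move: (a 0 0) => x /matrixP/(_ 0 0); rewrite !mxE !eqxx !mulr1n => xx.
have /eqP : x * (x - 1) = 0 by rewrite mulrBr mulr1 xx subrr.
rewrite mulf_eq0 subr_eq0 => /orP[] /eqP ->.
  by rewrite raddf0 mulmx0 mul0mx addr0 => <-; rewrite !block_mx0; left.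
by rewrite mulmx1 mul1mx (addmx_char2 char2) => <-; rewrite !scalar_mx_block; right.
Qed.

End ConcreteModules.

(** * Projective covers and simple modules *)

Section CyclicModules.
Variable k : fieldType.
Hypothesis char2 : (2 \in [pchar k])%N.

Variables (d : nat) (fa fb fc : nat -> nat -> bool).
Let P := @UMod k d (bmx k d d fa) (bmx k d d fb) (bmx k d d fc).
Let f := bletter fa fb fc.

(* P is presented as the left ideal A e: the i-th basis vector is ws_i applied to the
   generator, and cyclic_presentation says that the matrices of P are forced by identities
   of the algebra. *)
Definition cyclic_presentation (e : seq (seq nat)) (ws : seq (seq (seq nat))) : bool :=
  all (fun g => all (fun i =>
    nf (pmul [:: [:: g]] (pmul (nth [::] ws i) e) ++
        flatten [seq if f g j.+1 i.+1 then pmul (nth [::] ws j) e else [::] | j <- iota 0 d])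
    == [::]) (iota 0 d)) [:: 0; 1; 2]%N.

Variables (e : seq (seq nat)) (ws : seq (seq (seq nat))) (i0 : 'I_d).
Let g0 : 'cV[k]_d := delta_mx i0 0.
Hypothesis uP : is_umod P.
Hypothesis ee : nf (pmul e e ++ e) = [::].
Hypothesis pres : cyclic_presentation e ws.
Hypothesis ws0 : nth [::] ws i0 = [:: [::]].
Hypothesis eg0 : pval P e *m g0 = g0.
Hypothesis ws_basis : forall i : 'I_d, pval P (nth [::] ws i) *m g0 = delta_mx i 0.

Lemma letterE (X : umod k) g : letter X g = pval X [:: [:: g]].
Proof. by rewrite pval1 /= mulmx1. Qed.

Lemma hom_letter (X Y : umod k) (F : 'M_(udim Y, udim X)) :
  (forall g, g \in [:: 0; 1; 2]%N -> F *m letter X g = letter Y g *m F) -> is_hom F.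
Proof. by move=> homF; split; [apply: (homF 0%N)|apply: (homF 1%N)|apply: (homF 2%N)]. Qed.

(** Since [P] is the left ideal [A e], its homomorphisms to [X] are the vectors fixed by [e]; [v i]
    is the forced image of the [i]-th basis vector. *)
Lemma cyclic_hom (X : umod k) (x : 'cV_(udim X)) : is_umod X -> pval X e *m x = x ->
  exists h : 'M_(udim X, udim P), is_hom h /\ h *m g0 = x.
Proof.
move=> uX ex; pose v i := pval X (nth [::] ws i) *m (pval X e *m x).
pose h : 'M[k]_(udim X, udim P) := \matrix_(r, i) v i r 0.
have colh i : col i h = v i by apply/colP=> r; rewrite !mxE.
exists h; split; last by rewrite -colE colh /v ws0 pval1 mul1mx.
apply: hom_letter => g g_in; apply/matrixP=> r i.
have i_in : val i \in iota 0 d by rewrite mem_iota /= add0n ltn_ord.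
have /allP/(_ g g_in)/allP/(_ _ i_in)/eqP/(pval_eq char2 uX) := pres.
rewrite !pval_mul -letterE => E.
have flat s : pval X (flatten [seq if f g j.+1 i.+1 then pmul (nth [::] ws j) e else [::] | j <- s])
    *m x = \sum_(j <- s) b2k k (f g j.+1 i.+1) *: v j.
  elim: s => [|j s IH]; first by rewrite pval_nil mul0mx big_nil.
  rewrite big_cons -IH /= pval_cat mulmxDl; congr (_ + _).
  by case: (f g _ _); rewrite ?pval_mul ?scale1r -?mulmxA // pval_nil mul0mx scale0r.
have -> : (letter X g *m h) r i = (letter X g *m v i) r 0.
  by rewrite -colh colE mulmxA -colE [in RHS]mxE.
rewrite /v !mulmxA -[letter X g *m _ *m _]mulmxA E flat.
rewrite (_ : iota 0 d = index_iota 0 d) ?big_mkord; last by rewrite /index_iota subn0.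
rewrite summxE !mxE; apply: eq_bigr => j _.
by rewrite bletterE !mxE mulrC.
Qed.

Lemma cyclic_hom_eq (X : umod k) (h h' : 'M_(udim X, udim P)) :
  is_hom h -> is_hom h' -> h *m g0 = h' *m g0 -> h = h'.
Proof.
move=> homh homh' E; apply/matrixP=> r i.
have colE' (h1 : 'M_(udim X, udim P)) : is_hom h1 ->
    h1 r i = (pval X (nth [::] ws i) *m (h1 *m g0)) r 0.
  move=> hom1; rewrite mulmxA -(hom_pval _ hom1) -mulmxA ws_basis -colE.
  by rewrite mxE.
by rewrite (colE' h) // (colE' h') // E.
Qed.

Lemma cyclic_projective : projective_umod P.
Proof.
split=> // X Y g h uX uY homg /eqP surg homh.
have gK : g *m pinvmx g = 1%:M by rewrite mulmxVp.
pose x := pval X e *m (pinvmx g *m (h *m g0)).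
have [|h' [homh' h'g0]] := cyclic_hom uX (x := x).
  by rewrite mulmxA -pval_mul (pval_eq char2 uX ee).
exists h'; split=> //; apply: cyclic_hom_eq => //; first exact: (hom_comp homh' homg).
rewrite -mulmxA h'g0 /x mulmxA (hom_pval _ homg) -mulmxA [g *m (_ *m _)]mulmxA gK mul1mx.
by rewrite mulmxA -(hom_pval _ homh) -mulmxA eg0.
Qed.

(** The hypotheses say that [e P] is spanned by the generator and by [s], where [s] is in the kernel
    of [p] and [sigma] acts as a square-zero operator. If [p h] is onto, projectivity gives [h']
    with [p h h' = p]. Then [N = h h' - 1] sends the generator to a multiple of [s] and kills [s],
    so [N^2 = 0] and [h h'] is invertible. *)
Lemma cyclic_cover (V : umod k) (p : 'M_(udim V, udim P)) (s : 'cV_d) (gs ss : 'rV_d) sigma :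
    is_umod V -> is_hom p -> \rank p = udim V -> pval P e = g0 *m gs + s *m ss ->
    p *m g0 != 0 -> p *m s = 0 -> pval P sigma *m g0 = s -> pval P sigma *m s = 0 ->
  projective_cover P V.
Proof.
move=> uV homp rkp eE pg0 ps sg0 s0; have projP := cyclic_projective.
split=> //; split=> //; exists p; split=> // X h uX homh rkph.
have [h' [homh' ph']] := projP.2 _ _ _ _ uX uV (hom_comp homh homp) rkph homp.
pose N : 'M[k]_(udim P, udim P) := h *m h' - 1%:M.
have homN : is_hom N.
  have [Ea Eb Ec] := hom_comp homh' homh.
  by split; rewrite mulmxBl mulmxBr mul1mx mulmx1 ?Ea ?Eb ?Ec.
have pN : p *m N = 0 by rewrite mulmxBr mulmxA ph' mulmx1 subrr.
have Ng0 : N *m g0 = s *m (ss *m (N *m g0)).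
  have E : N *m g0 = g0 *m (gs *m (N *m g0)) + s *m (ss *m (N *m g0)).
    by rewrite -{1}eg0 mulmxA (hom_pval _ homN) eE -mulmxA mulmxDl -!mulmxA.
  have : p *m (N *m g0) = 0 by rewrite mulmxA pN mul0mx.
  rewrite {1}E mulmxDr !(mulmxA p) ps mul0mx addr0 [gs *m _]mx11_scalar.
  rewrite mul_mx_scalar => /eqP; rewrite scaler_eq0 (negbTE pg0) orbF => /eqP c0.
  by rewrite {1}E [gs *m _]mx11_scalar c0 raddf0 mulmx0 add0r.
have Ns : N *m s = 0.
  by rewrite -sg0 mulmxA (hom_pval _ homN) -mulmxA Ng0 [pval P sigma *m (s *m _)]mulmxA s0 mul0mx.
have NN : N *m N = 0.
  apply: cyclic_hom_eq; first exact: (hom_comp homN homN).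
    by split; rewrite mulmx0 mul0mx.
  by rewrite -mulmxA Ng0 [N *m (s *m _)]mulmxA Ns !mul0mx.
have hh : h *m (h' *m (1%:M - N)) = 1%:M.
  rewrite mulmxA (_ : h *m h' = N + 1%:M); last by rewrite subrK.
  by rewrite mulmxBr mulmx1 mulmxDl NN mul1mx add0r addrAC subrr add0r.
apply/eqP; rewrite eqn_leq rank_leq_row -{1}(mxrank1 k (udim P)) -hh.
exact: mxrankM_maxl.
Qed.

End CyclicModules.

(** If the algebra acts through all matrix units, any nonzero vector of a submodule is moved to
    every basis vector. *)
Lemma matrix_units_simple (k : fieldType) (S : umod k)
    (E : 'I_(udim S) -> 'I_(udim S) -> seq (seq nat)) :
    is_umod S -> (0 < udim S)%N -> (forall i j, pval S (E i j) = delta_mx i j) ->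
  simple_umod S.
Proof.
move=> uS S0 unitE; split=> // X F uX homF rkF.
have [F0|/matrix0Pn[i [j Fij]]] := eqVneq F 0; first by left; rewrite -rkF F0 mxrank0.
(* The matrix unit [E l i] carries [F] of the [j]-th basis vector to [F i j] times the [l]-th one;
   dividing by [F i j] gives a right inverse of [F]. *)
right; pose H : 'M[k]_(udim X, udim S) :=
  (F i j)^-1 *: \sum_l (pval X (E l i) *m delta_mx j l).
have FH : F *m H = 1%:M.
  rewrite -scalemxAr mulmx_sumr.
  transitivity ((F i j)^-1 *: \sum_l (F i j *: (delta_mx l l : 'M[k]_(udim S)))).
    congr (_ *: _); apply: eq_bigr => l _.
    rewrite mulmxA (hom_pval _ homF) unitE.
    rewrite -(mul_delta_mx (0 : 'I_1) l i) -(mul_delta_mx (0 : 'I_1) j l).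
    rewrite -(mul_delta_mx (0 : 'I_1) l l) -!mulmxA scalemxAr; congr (_ *m _).
    rewrite !mulmxA -rowE -colE [col _ _]mx11_scalar -mul_scalar_mx; congr (_%:M *m _).
    by rewrite !mxE.
  by rewrite -scaler_sumr scalerA mulVf // scale1r -mx1_sum_delta.
apply/eqP; rewrite eqn_leq rank_leq_row -{1}(mxrank1 k (udim S)) -FH.
exact: mxrankM_maxl.
Qed.

(** * The simple modules and their projective covers *)

Section Concrete.
Variable k : fieldType.
Hypothesis char2 : (2 \in [pchar k])%N.

Lemma bmx_delta m n (i : 'I_m) (j : 'I_n) :
  delta_mx i j = bmx k m n (fun p q => (p == i.+1) && (q == j.+1)).
Proof.
by apply/matrixP=> p q; rewrite !mxE !eqSS !(inj_eq val_inj); case: andP.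
Qed.

Lemma bmx_neq0 m n (f : nat -> nat -> bool) (i : 'I_m) (j : 'I_n) : f i.+1 j.+1 -> bmx k m n f != 0.
Proof.
move=> fij; apply/eqP => /matrixP/(_ i j)/eqP.
by rewrite !mxE fij /= oner_eq0.
Qed.

Lemma right_inverse_rank m n (A : 'M[k]_(m, n)) (B : 'M_(n, m)) :
  A *m B = 1%:M -> \rank A = m.
Proof.
move=> AB; apply/eqP; rewrite eqn_leq rank_leq_row -{1}(mxrank1 k m) -AB.
exact: mxrankM_maxl.
Qed.

Definition V0_b : umod k := @UMod k 1 (bmx k 1 1 (fun _ _ => false))
  (bmx k 1 1 (fun _ _ => false)) (bmx k 1 1 (fun _ _ => false)).
Definition V1_b : umod k := @UMod k 3 (bmx k 3 3 (fun p q => (p == q.+1) && (q < 3)%N))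
  (bmx k 3 3 (fun p q => (q == p.+1) && (1 < q)%N)) (bmx k 3 3 (fun p q => (p == q) && odd q)).

Lemma V0bE : V0 k = V0_b.
Proof. by rewrite /V0_b !bmx0. Qed.

Lemma V1bE : V1 k = V1_b.
Proof. by congr UMod; apply/matrixP=> p q; rewrite !mxE // if_same addr0. Qed.

(** The words producing [v_1, ..., v_4, w_1, ..., w_4] from the generator, [w_1] for [M] and [w_2]
    for [N]. In [N] the vector [w_1] is [b w_2 + v_2], hence a sum of two words. *)
Definition M_ws : seq (seq (seq nat)) :=
  [:: [:: [:: 1; 1; 1]]; [:: [:: 1; 1]]; [:: [:: 1]]; [:: [:: 0; 1]];
      [:: [::]]; [:: [:: 0]]; [:: [:: 0; 0]]; [:: [:: 0; 0; 0]]]%N.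

Definition N_ws : seq (seq (seq nat)) :=
  [:: [:: [:: 1; 1]]; [:: [:: 0; 1; 1]]; [:: [:: 0; 0; 1; 1]]; [:: [:: 0; 0; 0; 1; 1]];
      [:: [:: 1]; [:: 0; 1; 1]]; [:: [::]]; [:: [:: 0]]; [:: [:: 0; 0]]]%N.

Lemma Mmod_umod : is_umod (Mmod k).
Proof. exact: iso_umod (Mmod_iso char2) (Phi_umod char2 (free_rel char2)). Qed.

Lemma Nmod_umod : is_umod (Nmod k).
Proof.
exact: iso_umod (Nmod_iso char2) (Phi_umod char2 (graded_rel_swap (free_rel char2))).
Qed.

Lemma V0_umod : is_umod (V0 k).
Proof. by rewrite /is_umod /= !(mulmx0, addr0). Qed.

Lemma V1_umod : is_umod (V1 k).
Proof.
rewrite V1E; apply: iso_umod (fam2_iso _ (isT : (0 <= 1 <= 1)%N)) _.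
exact: (Phi_umod char2 (graded_rel_pencil (T2A k 1 0) (T2B k 1 0))).
Qed.

Lemma basis_check d fa fb fc (i0 : 'I_d) ws :
    all (fun i => beq d 1 (bmul d d 1 (bpoly d fa fb fc (nth [::] ws i))
                            (fun p q => (p == i0.+1) && (q == 1%N)))
                          (fun p q => (p == i.+1) && (q == 1%N))) (iota 0 d) ->
  forall i : 'I_d, pval (@UMod k d (bmx k d d fa) (bmx k d d fb) (bmx k d d fc))
    (nth [::] ws i) *m delta_mx i0 (0 : 'I_1) = delta_mx i 0.
Proof.
move=> /allP H i; rewrite (bpolyE char2) !bmx_delta (bmxM char2).
by apply: bmx_eq; apply: H; rewrite mem_iota /= add0n ltn_ord.
Qed.

Ltac bcheck := rewrite ?bmx_delta ?(bpolyE char2) ?bmx_tr ?(bmxM char2)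
  -?(bmx0 k) -?(bmx1 k) ?(bmxD char2) ?(bmxM char2); apply: bmx_eq; vm_compute; reflexivity.

Lemma Mmod_cover : projective_cover (Mmod k) (V0 k).
Proof.
rewrite V0bE MmodE.
(* Index 4 counted from 0 is [w_1]; [s] is [v_4 = a^2 b^2 w_1], and [p] is the coordinate of
   [w_1]. *)
pose i0 := Ordinal (isT : (4 < 8)%N); pose s := bmx k 8 1 (fun i _ => i == 4)%N.
pose row i := bmx k 1 8 (fun _ j => bpoly 8 aMN_b bM_b cM_b w_e0 i j).
pose p := bmx k 1 8 (fun _ j => j == 5)%N.
apply: (@cyclic_cover k char2 8 aMN_b bM_b cM_b w_e0 M_ws i0 _ _ _ _ _ _
  V0_b p s (row 5) (row 4) [:: [:: 0; 0; 1; 1]]%N); rewrite /p /s /row /i0.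
- exact: Mmod_umod.
- by vm_compute.
- by vm_compute.
- by [].
- bcheck.
- by apply: basis_check; vm_compute.
- rewrite -V0bE; exact: V0_umod.
- split; rewrite /=; bcheck.
- apply: (right_inverse_rank (B := p^T)); rewrite /p /=; bcheck.
- bcheck.
- rewrite bmx_delta (bmxM char2); exact: (bmx_neq0 (i := 0) (j := 0)).
- bcheck.
- bcheck.
- bcheck.
Qed.

Lemma Nmod_cover : projective_cover (Nmod k) (V1 k).
Proof.
rewrite V1bE NmodE.
(* Index 5 counted from 0 is [w_2]; [s] is [v_3 = a^2 b^2 w_2], and [p] sends [w_1, w_2, w_3] to the
   basis of [V1]. *)
pose i0 := Ordinal (isT : (5 < 8)%N); pose s := bmx k 8 1 (fun i _ => i == 3)%N.
pose row i := bmx k 1 8 (fun _ j => bpoly 8 aMN_b bN_b cN_b w_e1 i j).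
pose p := bmx k 3 8 (fun i j => j == i + 4)%N.
apply: (@cyclic_cover k char2 8 aMN_b bN_b cN_b w_e1 N_ws i0 _ _ _ _ _ _
  V1_b p s (row 6) (row 3) [:: [:: 0; 0; 1; 1]]%N); rewrite /p /s /row /i0.
- exact: Nmod_umod.
- by vm_compute.
- by vm_compute.
- by [].
- bcheck.
- by apply: basis_check; vm_compute.
- rewrite -V1bE; exact: V1_umod.
- split; rewrite /=; bcheck.
- apply: (right_inverse_rank (B := p^T)); rewrite /p /=; bcheck.
- bcheck.
- rewrite bmx_delta (bmxM char2); exact: (bmx_neq0 (i := Ordinal (isT : (1 < 3)%N)) (j := 0)).
- bcheck.
- bcheck.
- bcheck.
Qed.

Lemma V0_simple : simple_umod (V0 k).
Proof.
apply: (matrix_units_simple (E := fun _ _ => [:: [::]])) => //; first exact: V0_umod.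
by move=> i j; rewrite pval1; apply/matrixP=> p q; rewrite !mxE !ord1.
Qed.

(* The rows and columns are reached from the middle basis vector, cut out by 1 + c. *)
Lemma V1_simple : simple_umod (V1 k).
Proof.
pose E (i j : 'I_3) : seq (seq nat) := 
  pmul (nth [::] [:: [:: [:: 1]]; [:: [::]]; [:: [:: 0]]]%N i)
    (pmul [:: [::]; [:: 2]]%N (nth [::] [:: [:: [:: 0]]; [:: [::]]; [:: [:: 1]]]%N j)).
rewrite V1bE; apply: (@matrix_units_simple _ V1_b E) => //.
  by rewrite -V1bE; exact: V1_umod.
by move=> [[|[|[|i]]] lti] // [[|[|[|j]]] ltj] //; rewrite /E; bcheck.
Qed.

End Concrete.

(** * The classification *)

Section Classification.
Variable k : closedFieldType.
Hypothesis char2 : (2 \in [pchar k])%N.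

Definition umod_indec (X : umod k) := is_umod X /\ indecomposable X.

Lemma umod_indec_iso X Y : umod_iso X Y -> umod_indec Y -> umod_indec X.
Proof.
by move=> XY [uY indY]; split; [apply: iso_umod XY uY|apply: iso_indecomposable XY indY].
Qed.

Lemma Phi_umod_indec n0 n1 (p01 q01 : 'M[k]_(n1, n0)) (p10 q10 : 'M[k]_(n0, n1)) :
    graded_rel p01 q01 p10 q10 -> graded_indec p01 q01 p10 q10 ->
  umod_indec (Phi p01 q01 p10 q10).
Proof. by move=> rel ind; split; [apply: Phi_umod | apply: Phi_indec]. Qed.

Lemma Phi_pencil_umod_indec s w (A B : 'M[k]_(s, w)) : pencil_indec A B ->
  umod_indec (Phi A B 0 0) /\ umod_indec (Phi 0 0 A B).
Proof.
move=> /graded_indec_pencil ind; have rel := graded_rel_pencil A B; split.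
  exact: Phi_umod_indec.
by apply: Phi_umod_indec; [apply: graded_rel_swap|apply: graded_indec_swap].
Qed.

Lemma fam1_indec s w lam : (s <= w <= s.+1)%N -> (0 < w)%N ->
  umod_indec (fam1 (w + s + (s + s)) (lam : k)).
Proof.
move=> le_sw w_gt0; apply: umod_indec_iso (fam1_iso _ le_sw) _.
exact: (Phi_pencil_umod_indec (T1_indec lam le_sw w_gt0)).1.
Qed.

Lemma fam2_indec s w : (w <= s <= w.+1)%N -> (0 < s)%N ->
  umod_indec (fam2 k (w + s + (s + s))).
Proof.
move=> le_ws s_gt0; apply: umod_indec_iso (fam2_iso _ le_ws) _.
exact: (Phi_pencil_umod_indec (T2_indec _ le_ws s_gt0)).1.
Qed.

Lemma fam3_indec s w lam : (s <= w <= s.+1)%N -> (0 < w)%N ->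
  umod_indec (fam3 (s + w + (w + w)) (lam : k)).
Proof.
move=> le_sw w_gt0; apply: umod_indec_iso (fam3_iso _ le_sw) _.
exact: (Phi_pencil_umod_indec (T1_indec lam le_sw w_gt0)).2.
Qed.

Lemma fam4_indec s w : (w <= s <= w.+1)%N -> (0 < s)%N ->
  umod_indec (fam4 k (s + w + (w + w))).
Proof.
move=> le_ws s_gt0; apply: umod_indec_iso (fam4_iso _ le_ws) _.
exact: (Phi_pencil_umod_indec (T2_indec _ le_ws s_gt0)).2.
Qed.

Lemma in_list_indec (X : umod k) : in_list X -> umod_indec X.
Proof.
case=> [[]XL|[i [r [/andP[i1 i4] r1 XL]]]|[j [t [j12 [] XL]]]|[lam [n [lam0 n1 [] XL]]]];
  apply: umod_indec_iso XL _.
- by rewrite V0E; apply: fam1_indec.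
- by rewrite V1E; apply: fam2_indec.
- apply: umod_indec_iso (Mmod_iso char2) _.
  by apply: Phi_umod_indec; [apply: free_rel|apply: free_indec].
- apply: umod_indec_iso (Nmod_iso char2) _; apply: Phi_umod_indec.
    by apply: graded_rel_swap; apply: free_rel.
  by apply: graded_indec_swap; apply: free_indec.
- case: i i1 i4 => [|[|[|[|i]]]] //= _ _.
  + by rewrite U1E; apply: fam1_indec; rewrite // leqnSn leqnn.
  + by rewrite U2E; apply: fam2_indec; rewrite // leqnSn leqnn.
  + by rewrite U3E; apply: fam3_indec; rewrite // leqnSn leqnn.
  + by rewrite U4E; apply: fam4_indec; rewrite // leqnSn leqnn.
- rewrite /Vmod; case: eqP => _.
    by rewrite Vs1E; apply: fam1_indec; rewrite // leqnSn leqnn.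
  by rewrite Vs2E; apply: fam2_indec; rewrite // leqnSn leqnn.
- rewrite /Wmod; case: eqP => _.
    by rewrite W1E; apply: fam3_indec; rewrite // leqnSn leqnn.
  by rewrite W2E; apply: fam4_indec; rewrite // leqnSn leqnn.
- by rewrite AbandE; apply: fam1_indec; rewrite // leqnSn leqnn.
- by rewrite BbandE; apply: fam3_indec; rewrite // leqnSn leqnn.
Qed.

(** A square pencil gives a band if [lam] is nonzero and a string of type [V] if it is zero; a
    nonsquare one gives [U1], or [V0] when [s = 0]. The other three families are sorted in the same
    way. *)
Lemma in_list_fam1 X s w lam : (s <= w <= s.+1)%N -> (0 < w)%N -> ((s < w)%N -> lam = 0) ->
  umod_iso X (fam1 (w + s + (s + s)) (lam : k)) -> in_list X.
Proof.
move=> le_sw w_gt0 lam0; have [sw|lt_sw] := leqP w s.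
  have ws : w = s by lia.
  subst w; have [->|lamn0] := eqVneq lam 0.
    case: s w_gt0 {le_sw lam0 sw} => // t _; rewrite -Vs1E => XL.
    by apply: Or43; exists 1%N, t; split=> //; left.
  by rewrite -AbandE => XL; apply: Or44; exists lam, s; split=> //; left.
have ws : w = s.+1 by lia.
rewrite (lam0 lt_sw); subst w; case: s {le_sw lam0 lt_sw w_gt0} => [|r] XL.
  by apply: Or41; apply: Or41; rewrite V0E.
by apply: Or42; exists 1%N, r.+1; rewrite /Umod U1E.
Qed.

Lemma in_list_fam3 X s w lam : (s <= w <= s.+1)%N -> (0 < w)%N -> ((s < w)%N -> lam = 0) ->
  umod_iso X (fam3 (s + w + (w + w)) (lam : k)) -> in_list X.
Proof.
move=> le_sw w_gt0 lam0; have [sw|lt_sw] := leqP w s.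
  have ws : w = s by lia.
  subst w; have [->|lamn0] := eqVneq lam 0.
    case: s w_gt0 {le_sw lam0 sw} => // t _; rewrite -W1E => XL.
    by apply: Or43; exists 1%N, t; split=> //; right.
  by rewrite -BbandE => XL; apply: Or44; exists lam, s; split=> //; right.
have ws : w = s.+1 by lia.
rewrite (lam0 lt_sw); subst w; case: s {le_sw lam0 lt_sw w_gt0} => [|r] XL.
  by apply: Or41; apply: Or42; rewrite V1E'.
by apply: Or42; exists 3%N, r.+1; rewrite /Umod U3E.
Qed.

Lemma in_list_fam2 X s w : (w <= s <= w.+1)%N -> (0 < s)%N ->
  umod_iso X (fam2 k (w + s + (s + s))) -> in_list X.
Proof.
move=> le_ws s_gt0; have [sw|lt_ws] := leqP s w.
  have ws : w = s by lia.
  subst w; case: s s_gt0 {le_ws sw} => // t _; rewrite -Vs2E => XL.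
  by apply: Or43; exists 2%N, t; split=> //; left.
have ws : s = w.+1 by lia.
subst s; case: w {le_ws lt_ws s_gt0} => [|r] XL.
  by apply: Or41; apply: Or42; rewrite V1E.
by apply: Or42; exists 2%N, r.+1; rewrite /Umod U2E.
Qed.

Lemma in_list_fam4 X s w : (w <= s <= w.+1)%N -> (0 < s)%N ->
  umod_iso X (fam4 k (s + w + (w + w))) -> in_list X.
Proof.
move=> le_ws s_gt0; have [sw|lt_ws] := leqP s w.
  have ws : w = s by lia.
  subst w; case: s s_gt0 {le_ws sw} => // t _; rewrite -W2E => XL.
  by apply: Or43; exists 2%N, t; split=> //; right.
have ws : s = w.+1 by lia.
subst s; case: w {le_ws lt_ws s_gt0} => [|r] XL.
  by apply: Or41; apply: Or41; rewrite V0E'.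
by apply: Or42; exists 4%N, r.+1; rewrite /Umod U4E.
Qed.

Lemma indecomposable_in_list (X : umod k) : is_umod X -> indecomposable X -> in_list X.
Proof.
move=> uX indX; case: (umod_class char2 uX indX) => [XM|XN|[w [s [A [B [indAB XAB]]]]]].
- by apply: Or41; apply: Or43; apply: iso_trans XM (iso_sym (Mmod_iso char2)).
- by apply: Or41; apply: Or44; apply: iso_trans XN (iso_sym (Nmod_iso char2)).
have [n_gt0 _] := indAB.
case: (pencil_class char2 indAB) => [[le_ws]|[lam [le_sw lam0]]] /Phi_pencil_iso[iso1 iso2].
  have s_gt0 : (0 < s)%N by lia.
  case: XAB => XAB.
    apply: (in_list_fam2 le_ws s_gt0); apply: iso_trans (iso_trans XAB iso1) _.
    exact: iso_sym (fam2_iso _ le_ws).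
  apply: (in_list_fam4 le_ws s_gt0); apply: iso_trans (iso_trans XAB iso2) _.
  exact: iso_sym (fam4_iso _ le_ws).
have w_gt0 : (0 < w)%N by lia.
case: XAB => XAB.
  apply: (in_list_fam1 le_sw w_gt0 lam0); apply: iso_trans (iso_trans XAB iso1) _.
  exact: iso_sym (fam1_iso _ le_sw).
apply: (in_list_fam3 le_sw w_gt0 lam0); apply: iso_trans (iso_trans XAB iso2) _.
exact: iso_sym (fam3_iso _ le_sw).
Qed.

End Classification.

Theorem theorem4p1 (k : closedFieldType) (char2 : (2 \in [pchar k])%N) :
  [/\ simple_umod (V0 k) /\ simple_umod (V1 k),
      projective_cover (Mmod k) (V0 k) /\ projective_cover (Nmod k) (V1 k),
      (forall X : umod k, is_umod X -> indecomposable X -> in_list X) &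
      (forall X : umod k, in_list X -> is_umod X /\ indecomposable X)].
Proof.
split.
- by split; [apply: V0_simple|apply: V1_simple].
- by split; [apply: Mmod_cover|apply: Nmod_cover].
- exact: indecomposable_in_list.
- exact: in_list_indec.
Qed.
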